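(* Let $(A,\Delta)$ be an algebraic quantum group with dual $(\hat A,\hat\Delta)$, and let $R$ be a left $A$-module algebra. Let $\hat A$ act on the smash product $R\# A$ by the dual action $\omega(x\# a)=\sum \omega(a_{(2)})\, x\# a_{(1)}$ ($\omega\in\hat A$, $x\in R$, $a\in A$). Then the bismash product $(R\# A)\#\hat A$ is isomorphic, as an algebra, to the tensor product algebra $R\otimes (A\diamondsuit \hat A)$.
   Context: Algebras are over $\mathbb C$, possibly without identity, with non-degenerate product; $M(A)$ is the multiplier algebra and $A\otimes A\subseteq M(A\otimes A)$. A regular multiplier Hopf algebra is a pair $(A,\Delta)$ with $\Delta:A\to M(A\otimes A)$ a coassociative homomorphism such that $\Delta(a)(1\otimes b),(a\otimes 1)\Delta(b),\Delta(a)(b\otimes 1),(1\otimes a)\Delta(b)\in A\otimes A$ for all $a,b$, and the maps $a\otimes b\mapsto\Delta(a)(1\otimes b)$, $a\otimes b\mapsto (a\otimes1)\Delta(b)$ are bijective on $A\otimes A$, and the same holds for the flipped comultiplication; it has a counit $\varepsilon$ and a bijective antipode $S:A\to A$. Sweedler notation $\Delta(a)=\sum a_{(1)}\otimes a_{(2)}$ is used with all but one leg ''covered'' by other elements so that expressions lie in tensor products. An algebraic quantum group is a regular multiplier Hopf algebra admitting a left integral, i.e. a non-zero linear functional $\varphi$ on $A$ with $(\iota\otimes\varphi)\Delta(a)=\varphi(a)1$ for all $a$. Its dual is $\hat A=\{\varphi(\,\cdot\,c): c\in A\}\subseteq A'$ with product dual to $\Delta$ and comultiplication dual to the product of $A$;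 it is again an algebraic quantum group, paired with $A$ by $\langle a,\omega\rangle=\omega(a)$. A left $A$-module $R$ is unital if $AR=R$. A left $A$-module algebra is an algebra $R$ with non-degenerate product that is a unital left $A$-module with $a(xx')=\sum (a_{(1)}x)(a_{(2)}x')$ for all $a\in A$, $x,x'\in R$. For such $R$, the smash product $R\# A$ is the space $R\otimes A$ (elements written $x\# a$) with the associative product $(x\# a)(x'\# a')=\sum x(a_{(1)}x')\# a_{(2)}a'$; the dual action above makes $R\# A$ a $\hat A$-module algebra, and $(R\# A)\#\hat A$ is the corresponding smash product. $A\diamondsuit\hat A$ denotes the vector space $A\otimes\hat A$ (elements $a\diamondsuit\omega$) with product $(a\diamondsuit\omega)(a'\diamondsuit\omega')=\omega(a')\,a\diamondsuit\omega'$. *)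

(* Defs.v *)
From HB Require Import structures.
From mathcomp Require Import all_boot all_algebra sesquilinear.
From mathcomp Require Import complex Rstruct.
From mathcomp Require Import boolp functions.
Import GRing.Theory.
Local Open Scope ring_scope.

Set Implicit Arguments.
Unset Strict Implicit.
Unset Printing Implicit Defensive.

Notation CC := (complex Rdefinitions.R).

(* An element of U ⊗ V is modelled by the bilinear form it induces on        *)
(* U^* x V^*  (the canonical map U ⊗ V -> (U^* ⊗ V^* )^* is injective over a *)
(* field), restricted to those forms that come from a finite sum Σ u_i ⊗ v_i. *)
Section Tensor2.
Variables U V : lmodType CC.

Definition tev (s : seq (U * V)) : {scalar U} -> {scalar V} -> CC :=
  fun f g => \sum_(p <- s) f p.1 * g p.2.

Definition tensor := {t : {scalar U} -> {scalar V} -> CC | exists s, t = tev s}.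

Definition tensor_of (s : seq (U * V)) : tensor :=
  exist _ (tev s) (ex_intro _ s erefl).

Definition trep (t : tensor) : seq (U * V) := proj1_sig (cid (proj2_sig t)).

Definition tzero : tensor := tensor_of [::].
Definition tadd (t t' : tensor) : tensor := tensor_of (trep t ++ trep t').
Definition tscale (k : CC) (t : tensor) : tensor :=
  tensor_of [seq (k *: p.1, p.2) | p <- trep t].
Definition tsum (ts : seq tensor) : tensor := tensor_of (flatten (map trep ts)).
Definition tmap (f : U -> U) (g : V -> V) (t : tensor) : tensor :=
  tensor_of [seq (f p.1, g p.2) | p <- trep t].
Definition tlift (X : zmodType) (B : U -> V -> X) (t : tensor) : X :=
  \sum_(p <- trep t) B p.1 p.2.

End Tensor2.

Definition tflip (U V : lmodType CC) (t : tensor U V) : tensor V U :=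
  tensor_of [seq (p.2, p.1) | p <- trep t].

Section Tensor3.
Variables U V W : lmodType CC.

Definition tev3 (s : seq (U * V * W)) :
    {scalar U} -> {scalar V} -> {scalar W} -> CC :=
  fun f g h => \sum_(p <- s) f p.1.1 * g p.1.2 * h p.2.

Definition tensor3 :=
  {t : {scalar U} -> {scalar V} -> {scalar W} -> CC | exists s, t = tev3 s}.

Definition tensor3_of (s : seq (U * V * W)) : tensor3 :=
  exist _ (tev3 s) (ex_intro _ s erefl).
Definition trep3 (t : tensor3) : seq (U * V * W) := proj1_sig (cid (proj2_sig t)).

Definition tadd3 (t t' : tensor3) : tensor3 := tensor3_of (trep3 t ++ trep3 t').
Definition tscale3 (k : CC) (t : tensor3) : tensor3 :=
  tensor3_of [seq (k *: p.1.1, p.1.2, p.2) | p <- trep3 t].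

End Tensor3.

(* Multiplier algebra of a (possibly non-unital) algebra (T, m):             *)
(* pairs (λ, ρ) of maps with  x (λ y) = (ρ x) y ; λ y stands for "M y" and    *)
(* ρ x for "x M".                                                           *)
Record multiplier (T : Type) (m : T -> T -> T) := Multiplier {
  mleft : T -> T;
  mright : T -> T;
  _ : forall x y, m x (mleft y) = m (mright x) y }.

Section QuantumGroup.
Variable A : lmodType CC.
Variable mul : {bilinear A -> A -> A}.

Definition tmul (t t' : tensor A A) : tensor A A :=
  tensor_of [seq (mul p.1 q.1, mul p.2 q.2) | p <- trep t, q <- trep t'].

Definition in_tensor (l r : tensor A A -> tensor A A) : Prop :=
  exists u, (forall y, l y = tmul u y) /\ (forall x, r x = tmul x u).

Definition as_tensor (l r : tensor A A -> tensor A A) : tensor A A :=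
  match pselect (in_tensor l r) with
  | left h => proj1_sig (cid h)
  | right _ => tzero A A
  end.

Variable Delta : A -> multiplier tmul.

Definition DL a := mleft (Delta a).
Definition DR a := mright (Delta a).

(*  Δ(a)(1⊗b)  *)
Definition cov1_l a b := fun y => DL a (tmap id (mul b) y).
Definition cov1_r a b := fun x => tmap id (mul^~ b) (DR a x).
(*  (a⊗1)Δ(b)  *)
Definition cov2_l a b := fun y => tmap (mul a) id (DL b y).
Definition cov2_r a b := fun x => DR b (tmap (mul^~ a) id x).
(*  Δ(a)(b⊗1)  *)
Definition cov3_l a b := fun y => DL a (tmap (mul b) id y).
Definition cov3_r a b := fun x => tmap (mul^~ b) id (DR a x).
(*  (1⊗a)Δ(b)  *)
Definition cov4_l a b := fun y => tmap id (mul a) (DL b y).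
Definition cov4_r a b := fun x => DR b (tmap id (mul^~ a) x).

Definition D1 a b := as_tensor (cov1_l a b) (cov1_r a b).
Definition D2 a b := as_tensor (cov2_l a b) (cov2_r a b).
Definition D3 a b := as_tensor (cov3_l a b) (cov3_r a b).
Definition D4 a b := as_tensor (cov4_l a b) (cov4_r a b).

(* the linear maps a⊗b ↦ Δ(a)(1⊗b),  a⊗b ↦ (a⊗1)Δ(b) and the same for the
   flipped comultiplication Δ^op = σ∘Δ :
   Δ^op(a)(1⊗b) = σ(Δ(a)(b⊗1)),  (a⊗1)Δ^op(b) = σ((1⊗a)Δ(b)) *)
Definition T1 t := tsum [seq D1 p.1 p.2 | p <- trep t].
Definition T2 t := tsum [seq D2 p.1 p.2 | p <- trep t].
Definition T1op t := tsum [seq tflip (D3 p.1 p.2) | p <- trep t].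
Definition T2op t := tsum [seq tflip (D4 p.1 p.2) | p <- trep t].

(* (a⊗1⊗1)(Δ⊗ι)(Δ(b)(1⊗c)) *)
Definition coass_lhs a b c : tensor3 A A A :=
  tensor3_of (flatten [seq [seq (q.1, q.2, p.2) | q <- trep (D2 a p.1)]
                      | p <- trep (D1 b c)]).
(* (ι⊗Δ)((a⊗1)Δ(b))(1⊗1⊗c) *)
Definition coass_rhs a b c : tensor3 A A A :=
  tensor3_of (flatten [seq [seq (p.1, q.1, q.2) | q <- trep (D1 p.2 c)]
                      | p <- trep (D2 a b)]).

Definition slice_right (phi : {scalar A}) (t : tensor A A) : A :=
  tlift (fun y z => phi z *: y) t.

Record is_AQG (phi : {scalar A}) : Prop := {
  mul_assoc : forall a b c, mul a (mul b c) = mul (mul a b) c;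
  mul_nondeg_l : forall a, (forall b, mul a b = 0) -> a = 0;
  mul_nondeg_r : forall a, (forall b, mul b a = 0) -> a = 0;
  Delta_linear_l : forall k a b y,
    DL (k *: a + b) y = tadd (tscale k (DL a y)) (DL b y);
  Delta_linear_r : forall k a b x,
    DR (k *: a + b) x = tadd (tscale k (DR a x)) (DR b x);
  Delta_mul_l : forall a b y, DL (mul a b) y = DL a (DL b y);
  Delta_mul_r : forall a b x, DR (mul a b) x = DR b (DR a x);
  cover1 : forall a b, in_tensor (cov1_l a b) (cov1_r a b);
  cover2 : forall a b, in_tensor (cov2_l a b) (cov2_r a b);
  cover3 : forall a b, in_tensor (cov3_l a b) (cov3_r a b);
  cover4 : forall a b, in_tensor (cov4_l a b) (cov4_r a b);
  coassoc : forall a b c, coass_lhs a b c = coass_rhs a b c;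
  T1_bij : bijective T1;
  T2_bij : bijective T2;
  T1op_bij : bijective T1op;
  T2op_bij : bijective T2op;
  phi_nonzero : exists a, phi a != 0;
  phi_left_inv : forall a b, slice_right phi (D3 a b) = phi a *: b
}.

Variable phi : {scalar A}.

Definition dual_pred : pred (A -> CC^o) :=
  fun w => `[< exists c, w = (fun a => phi (mul a c)) >].

Lemma dual_pred_submod_closed : submod_closed dual_pred.
Proof.
split.
  apply/asboolP; exists 0; apply/funext => a /=.
  by rewrite linear0r linear0.
move=> k u v /asboolP [c ->] /asboolP [c' ->]; apply/asboolP.
exists (k *: c + c'); apply/funext => a /=.
by rewrite linearDr linearZr_LR linearD linearZ.
Qed.

HB.instance Definition _ := GRing.isSubmodClosed.Build CC (A -> CC^o) dual_pred
  dual_pred_submod_closed.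

Definition dualA := {w : A -> CC^o | w \in dual_pred}.
HB.instance Definition _ := [isSub of dualA for (@sval _ (fun w => w \in dual_pred))].
HB.instance Definition _ := [Choice of dualA by <:].
HB.instance Definition _ := [SubChoice_isSubLmodule of dualA by <:].

Definition dapp (w : dualA) (a : A) : CC := (val w) a.

Definition dcoef (w : dualA) : A :=
  proj1_sig (cid (elimT (asboolP _) (valP w))).

(* (ι⊗ω)Δ(b) = (ι⊗φ)(Δ(b)(1⊗c))  for ω = φ( . c) *)
Definition dslice (w : dualA) (b : A) : A := slice_right phi (D1 b (dcoef w)).

(* Δ^(ω)(1⊗ω') ∈ Â ⊗ Â, characterised by its pairing with A ⊗ A :
   <Δ^(ω)(1⊗ω'), a⊗b> = ω(a (ι⊗ω')Δ(b)) *)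
Definition dcop_prop (w w' : dualA) (T : tensor dualA dualA) : Prop :=
  forall a b, tlift (fun psi chi => dapp psi a * dapp chi b) T
              = dapp w (mul a (dslice w' b)).

Definition dcop (w w' : dualA) : tensor dualA dualA :=
  match pselect (exists T, dcop_prop w w' T) with
  | left h => proj1_sig (cid h)
  | right _ => tzero _ _
  end.

Variables (R : lmodType CC) (mulR : {bilinear R -> R -> R})
          (act : {bilinear A -> R -> R}).

Record is_module_algebra : Prop := {
  mulR_assoc : forall x y z, mulR x (mulR y z) = mulR (mulR x y) z;
  mulR_nondeg_l : forall x, (forall y, mulR x y = 0) -> x = 0;
  mulR_nondeg_r : forall x, (forall y, mulR y x = 0) -> x = 0;
  act_mul : forall a b x, act (mul a b) x = act a (act b x);
  act_unital : forall x, exists s : seq (A * R),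
                 x = \sum_(p <- s) act p.1 p.2;
  (* a(x x') = Σ (a_(1) x)(a_(2) x'), covered by writing x' = b x'' *)
  act_module_algebra : forall a b x x'',
    act a (mulR x (act b x'')) =
    \sum_(p <- trep (D1 a b)) mulR (act p.1 x) (act p.2 x'')
}.

(* product of the bismash product (R # A) # Â on R ⊗ A ⊗ Â :
   (X # ω)(X' # ω') = Σ X (ω_(1) ▷ X') # ω_(2) ω',
   with ω ▷ (x' # a') = x' # (ι⊗ω)Δ(a') and
   (x # a)(x' # a'') = Σ x (a_(1) x') # a_(2) a''  *)
Definition bismash_pure (p q : R * A * dualA) : seq (R * A * dualA) :=
  [seq (mulR p.1.1 (act yz.1 q.1.1), yz.2, k.2)
  | k <- trep (dcop p.2 q.2), yz <- trep (D1 p.1.2 (dslice k.1 q.1.2))].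

Definition bismash_mul (t t' : tensor3 R A dualA) : tensor3 R A dualA :=
  tensor3_of (flatten [seq bismash_pure p q | p <- trep3 t, q <- trep3 t']).

Definition diamond_mul (t t' : tensor3 R A dualA) : tensor3 R A dualA :=
  tensor3_of [seq (mulR p.1.1 q.1.1, dapp p.2 q.1.2 *: p.1.2, q.2)
             | p <- trep3 t, q <- trep3 t'].

End QuantumGroup.

Definition alg_iso (U V W : lmodType CC)
    (m1 m2 : tensor3 U V W -> tensor3 U V W -> tensor3 U V W)
    (F : tensor3 U V W -> tensor3 U V W) : Prop :=
  [/\ forall k t t', F (tadd3 (tscale3 k t) t') = tadd3 (tscale3 k (F t)) (F t'),
      bijective F &
      forall t t', F (m1 t t') = m2 (F t) (F t')].

(* Main.v *)
(** Write a_1 ⊗ a_2 for Δ(a).  The counit and the inverse antipode σ are obtained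
    from the bijectivity of a ⊗ b ↦ a_1 ⊗ a_2 b and a ⊗ b ↦ a_1 b ⊗ a_2; σ is onto,
    antimultiplicative and satisfies σ(x_2) x_1 y = ε(x) y.

    The algebra (R # A) # Â acts on R # A, by left multiplication and the dual
    action, and R ⊗ (A ◇ Â) acts on R ⊗ A, by x ⊗ a ◇ ω : y ⊗ b ↦ ω(b) xy ⊗ a.
    The map W : y ⊗ b ↦ b_1 y ⊗ b_2 from R ⊗ A to R # A is bijective (its inverse is
    r ⊗ q ↦ σ(q_1) r ⊗ q_2), and it carries the two algebras of operators onto each
    other: with x ⊗ - the left multiplication by x, the operator of x # a # ω
    becomes x · W(y ⊗ a (ω ▷ b)), and for ω = φ(· c) and a = σ(a')
      σ(a') (ω ▷ b) = Σ φ(b q) σ(p),  where Σ p ⊗ q = Δ(c)(a' ⊗ 1),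
    by the invariance of φ.  As c and a' vary these Σ p ⊗ q span A ⊗ A, and σ is
    onto, so that every operator y ⊗ b ↦ φ(b q) xy ⊗ p is reached.  Both actions are
    faithful, hence matching the operators defines the isomorphism. *)

Require Import Defs.
From HB Require Import structures.
From mathcomp Require Import all_boot all_algebra sesquilinear.
From mathcomp Require Import complex Rstruct.
From mathcomp Require Import boolp functions.
From mathcomp Require Import classical_sets.
Import GRing.Theory.
Local Open Scope ring_scope.

Set Implicit Arguments.
Unset Strict Implicit.
Unset Printing Implicit Defensive.

(** * Tensor products over a field *)

(** In general Δ(a) does not lie in A ⊗ A, and a Sweedler expression has a meaning only when all
    legs but one are covered. Coproducts therefore occur only as the four covered elements [d1] to
    [d4]. An identity between them is proved either by multiplying a leg by a further element,
    regrouping the covers and cancelling by non-degeneracy ([canc_l1], [canc_l2], [canc_r2]), or by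
    testing it on a family that spans because a canonical map is onto ([span_eq]). Both methods need
    linear maps out of a tensor product. The tensors of the statement are bare forms with a chosen
    representative; [ten] is the same space of forms with its module structure. Its universal
    property [tfold] needs enough linear functionals, hence Zorn's lemma. Comparing operators,
    instead of writing the isomorphism out, reduces its multiplicativity to the composition of
    maps. *)

Section Separation.
Variables (K : fieldType) (U : lmodType K).

Local Open Scope classical_set_scope.

Lemma separating_functional (v : U) : v != 0 -> exists f : {scalar U}, f v = 1.
Proof.
move=> v0.
pose P (H : set U) := (forall k u w, H u -> H w -> H (k *: u + w)) /\ ~ H v.
have [|H [[Hlin Hv] Hmax]] := @Zorn_bigcup U P.
  move=> F FP Ftot; split; last by case=> X /FP [_ ?].
  move=> k u w [X FX Xu] [Y FY Yw].
  case: (Ftot X Y FX FY) => [XY|YX].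
    by exists Y => //; apply: (FP Y FY).1 => //; apply: XY.
  by exists X => //; apply: (FP X FX).1 => //; apply: YX.
(* [H] may be empty, so the hyperplane is [H] with 0 adjoined. *)
pose H0 u := H u \/ u = 0.
have H0lin k u w : H0 u -> H0 w -> H0 (k *: u + w).
  move=> [Hu|->] [Hw|->].
  - by left; apply: Hlin.
  - case: (eqVneq k 0) => [->|k0]; first by right; rewrite scale0r addr0.
    left; rewrite addr0; have := Hlin (k - 1) u u Hu Hu.
    by rewrite scalerBl scale1r subrK.
  - by rewrite scaler0 add0r; left.
  - by rewrite scaler0 add0r; right.
have H0v : ~ H0 v by case=> // v_0; rewrite v_0 eqxx in v0.
have H0Z k u : H0 u -> H0 (k *: u).
  by move=> Hu; rewrite -[_ *: _]addr0; apply: H0lin => //; right.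
(* If [u] is outside [H0], the span of [H0] and [u] is too large for maximality, so it contains [v];
   solving for [u] gives its coefficient along [v]. *)
have decomp u : exists k, H0 (u - k *: v).
  case: (pselect (H0 u)) => Hu; first by exists 0; rewrite scale0r subr0.
  pose B w := exists h c, H0 h /\ w = h + c *: u.
  have HB : H `<` B.
    split; last by move=> /(_ u) BH; apply: Hu; left; apply: BH; exists 0, 1;
      split; [right|rewrite add0r scale1r].
    by move=> h Hh; exists h, 0; rewrite scale0r addr0; split => //; left.
  have := Hmax B HB; case: (pselect (B v)) => [[h [c [Hh vE]]] _|nBv []]; last first.
    split => // k _ _ [h [c [Hh ->]]] [h' [c' [Hh' ->]]].
    exists (k *: h + h'), (k * c + c'); split; first exact: H0lin.
    by rewrite scalerDl -scalerA scalerDr addrACA.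
  have c0 : c != 0.
    by apply/negP => /eqP c0; apply: H0v; rewrite vE c0 scale0r addr0.
  exists c^-1; rewrite {1}vE scalerDr scalerA mulVf // scale1r opprD addrCA subrr.
  by rewrite addr0 -scaleNr; apply: H0Z.
pose f u := proj1_sig (cid (decomp u)).
have fP u : H0 (u - f u *: v) := proj2_sig (cid (decomp u)).
have f_uniq u k : H0 (u - k *: v) -> f u = k.
  move=> Hk; apply/eqP; rewrite -subr_eq0; apply/negP => /negP fk.
  apply: H0v; have := H0lin (- 1) _ _ (fP u) Hk.
  rewrite scaleN1r opprB addrA subrK -scalerBl => /(H0Z (f u - k)^-1).
  by rewrite scalerA mulVf // scale1r.
have f_lin : scalar f.
  move=> k u w; apply: f_uniq.
  have -> : k *: u + w - (k * f u + f w) *: v =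
            k *: (u - f u *: v) + (w - f w *: v).
    by rewrite scalerDl scalerBr scalerA opprD addrACA.
  exact: H0lin.
pose fL := GRing.isLinear.Build K U K *%R f f_lin.
pose g : {scalar U} := HB.pack f fL.
by exists g; apply: (f_uniq v 1); rewrite scale1r subrr; right.
Qed.

End Separation.

Section DualBasis.
Variables (K : fieldType) (U : lmodType K).

(** Induction on [s]: [P] is the map given by the old family, and [g] takes the value 1 at
    [w - P w]. The functional u ↦ g(u - P u) vanishes on the old vectors, so its rank-one term
    repairs [w] and leaves them alone. *)
Lemma dual_basis (s : seq U) : exists e : seq ({scalar U} * U),
  forall u, u \in s -> u = \sum_(p <- e) p.1 u *: p.2.
Proof.
elim: s => [|w s [e IH]]; first by exists [::].
pose P u := \sum_(p <- e) p.1 u *: p.2.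
have P_lin k u v : P (k *: u + v) = k *: P u + P v.
  rewrite /P scaler_sumr -big_split; apply: eq_bigr => p _.
  by rewrite linearP scalerDl scalerA.
case: (eqVneq (w - P w) 0) => [/eqP|/separating_functional [g gw]].
  by rewrite subr_eq0 => /eqP wP; exists e => u; rewrite inE => /orP [/eqP ->|/IH].
have h_lin : scalar (fun u => g (u - P u)).
  move=> k u v; rewrite P_lin -linearP; congr (g _).
  by rewrite scalerBr opprD addrACA.
pose hL := GRing.isLinear.Build K U K *%R _ h_lin.
pose h : {scalar U} := HB.pack (fun u => g (u - P u)) hL.
exists ((h, w - P w) :: e) => u; rewrite inE big_cons /= -/(P u) => /orP [/eqP ->|/IH uP].
  by rewrite gw scale1r subrK.
by rewrite {1 2}/P -uP subrr linear0 scale0r add0r.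
Qed.

End DualBasis.

(** * Linearity as a predicate *)

Section Linearity.
Variable K : fieldType.

(** A predicate rather than a bundled morphism: the maps below are λ-terms, and the tactic [linear]
    derives their linearity from the shape of the term. *)
Definition lin (U V : lmodType K) (f : U -> V) :=
  forall k u v, f (k *: u + v) = k *: f u + f v.

Definition bil (U V X : lmodType K) (B : U -> V -> X) :=
  (forall u, lin (B u)) /\ (forall v, lin (B^~ v)).

Variables U V W X : lmodType K.

Lemma linD (f : U -> V) : lin f -> {morph f : u v / u + v}.
Proof. by move=> fl u v; rewrite -[u]scale1r fl !scale1r. Qed.

Lemma lin0 (f : U -> V) : lin f -> f 0 = 0.
Proof. by move=> /linD fD; apply: (addrI (f 0)); rewrite -fD !addr0. Qed.

Lemma linZ (f : U -> V) : lin f -> forall k u, f (k *: u) = k *: f u.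
Proof. by move=> fl k u; rewrite -[k *: u]addr0 fl (lin0 fl) addr0. Qed.

Lemma linB (f : U -> V) : lin f -> {morph f : u v / u - v}.
Proof.
by move=> fl u v; rewrite linD // -scaleN1r linZ // scaleN1r.
Qed.

Lemma lin_sum (f : U -> V) : lin f -> forall (I : Type) (s : seq I) (F : I -> U),
  f (\sum_(i <- s) F i) = \sum_(i <- s) f (F i).
Proof. by move=> fl I s F; apply: big_morph; [apply: linD|apply: lin0]. Qed.

Lemma lin_inj (f : U -> V) : lin f -> (forall u, f u = 0 -> u = 0) -> injective f.
Proof.
move=> fl f0 u v fuv; apply/eqP; rewrite -subr_eq0; apply/eqP/f0.
by rewrite linB // fuv subrr.
Qed.

Lemma lin_id : lin (@id U). Proof. by []. Qed.

Lemma lin_comp (g : V -> W) (f : U -> V) : lin g -> lin f -> lin (fun u => g (f u)).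
Proof. by move=> gl fl k u v; rewrite fl gl. Qed.

Lemma lin_zero : lin (fun _ : U => 0 : V).
Proof. by move=> k u v; rewrite scaler0 addr0. Qed.

Lemma lin_add (f g : U -> V) : lin f -> lin g -> lin (fun u => f u + g u).
Proof. by move=> fl gl k u v; rewrite fl gl scalerDr addrACA. Qed.

Lemma lin_scale (c : K) (f : U -> V) : lin f -> lin (fun u => c *: f u).
Proof. by move=> fl k u v; rewrite fl scalerDr !scalerA mulrC. Qed.

Lemma lin_scalel (f : U -> K^o) (x : V) : lin f -> lin (fun u => (f u : K) *: x).
Proof. by move=> fl k u v; rewrite fl scalerDl scalerA. Qed.

Lemma lin_bigsum (I : Type) (s : seq I) (F : I -> U -> V) :
  (forall i, lin (F i)) -> lin (fun u => \sum_(i <- s) F i u).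
Proof.
move=> Fl k u v; rewrite scaler_sumr -big_split; apply: eq_bigr => i _; exact: Fl.
Qed.

Lemma lin_bilr (B : U -> V -> X) (u : U) (f : W -> V) :
  bil B -> lin f -> lin (fun w => B u (f w)).
Proof. by move=> [Br _] fl k w w'; rewrite fl Br. Qed.

Lemma lin_bill (B : U -> V -> X) (v : V) (f : W -> U) :
  bil B -> lin f -> lin (fun w => B (f w) v).
Proof. by move=> [_ Bl] fl k w w'; rewrite fl; apply: Bl. Qed.

End Linearity.

(** * The tensor product and its universal property *)

Section TensorProduct.
Variables (K : fieldType) (U V : lmodType K).

Definition tform (s : seq (U * V)) : {scalar U} -> {scalar V} -> K^o :=
  fun f g => \sum_(p <- s) f p.1 * g p.2.

Definition tform_pred : pred ({scalar U} -> {scalar V} -> K^o) :=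
  fun t => `[< exists s, t = tform s >].

Lemma tform_submod_closed : submod_closed tform_pred.
Proof.
split.
  apply/asboolP; exists [::]; apply/funext => f; apply/funext => g.
  by rewrite /tform big_nil.
move=> k _ _ /asboolP [s ->] /asboolP [s' ->]; apply/asboolP.
exists ([seq (k *: p.1, p.2) | p <- s] ++ s'); apply/funext => f; apply/funext => g.
rewrite /tform big_cat big_map /=; congr (_ + _).
rewrite [LHS](_ : _ = k * \sum_(p <- s) f p.1 * g p.2) // big_distrr /=.
by apply: eq_bigr => p _; rewrite linearZ mulrA.
Qed.

HB.instance Definition _ := GRing.isSubmodClosed.Build K
  ({scalar U} -> {scalar V} -> K^o) tform_pred tform_submod_closed.

(** A boolean predicate cuts out the forms of finite sums, so that they inherit the module structure
    of the function space. *)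
Definition ten := {t : {scalar U} -> {scalar V} -> K^o | t \in tform_pred}.
HB.instance Definition _ := [isSub of ten for (@sval _ (fun t => t \in tform_pred))].
HB.instance Definition _ := [Choice of ten by <:].
HB.instance Definition _ := [SubChoice_isSubLmodule of ten by <:].

Fact tform_in s : tform s \in tform_pred.
Proof. by apply/asboolP; exists s. Qed.

Definition tn (u : U) (v : V) : ten := exist _ (tform [:: (u, v)]) (tform_in _).

Definition rep (t : ten) : seq (U * V) :=
  proj1_sig (cid (elimT (asboolP _) (valP t))).

Lemma rep_form (t : ten) : val t = tform (rep t).
Proof. exact: (proj2_sig (cid (elimT (asboolP _) (valP t)))). Qed.

Definition tfold (X : lmodType K) (B : U -> V -> X) (t : ten) : X :=
  \sum_(p <- rep t) B p.1 p.2.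

(** This is why [tfold] does not depend on the representative: expanded in finite dual bases of the
    two legs, the sum is a combination of the vectors [B i.2 j.2] whose coefficients are values of
    the form of [s]. *)
Lemma bil_form (X : lmodType K) (B : U -> V -> X) (s : seq (U * V)) :
  bil B -> tform s = (fun _ _ => 0) -> \sum_(p <- s) B p.1 p.2 = 0.
Proof.
move=> [Br Bl] s0.
have [e eP] := dual_basis [seq p.1 | p <- s].
have [e' eP'] := dual_basis [seq p.2 | p <- s].
transitivity (\sum_(p <- s) \sum_(i <- e) \sum_(j <- e')
                (i.1 p.1 * j.1 p.2) *: B i.2 j.2).
  apply: eq_big_seq => p ps.
  rewrite {1}(eP p.1) ?(map_f fst) // (lin_sum (Bl _)); apply: eq_bigr => i _.
  rewrite (linZ (Bl _)) {1}(eP' p.2) ?(map_f snd) // (lin_sum (Br _)) scaler_sumr.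
  by apply: eq_bigr => j _; rewrite (linZ (Br _)) scalerA.
rewrite exchange_big big1 // => i _; rewrite exchange_big big1 // => j _.
rewrite -scaler_suml.
have -> : \sum_(p <- s) i.1 p.1 * j.1 p.2 = tform s i.1 j.1 by [].
by rewrite s0 scale0r.
Qed.

Lemma form_valP (k : K) (F G : {scalar U} -> {scalar V} -> K^o) f g :
  (k *: F + G) f g = k * (F f g : K) + (G f g : K).
Proof. by []. Qed.

Lemma val_tenP (k : K) (t t' : ten) : val (k *: t + t') = k *: val t + val t'.
Proof. reflexivity. Qed.

Lemma ten_valP (k : K) (t t' : ten) f g :
  val (k *: t + t') f g = k * (val t f g : K) + (val t' f g : K).
Proof. by rewrite val_tenP form_valP. Qed.

Section TFold.
Variables (X : lmodType K) (B : U -> V -> X).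
Hypothesis B_bil : bil B.

Lemma tfold_form (t : ten) (s : seq (U * V)) :
  val t = tform s -> tfold B t = \sum_(p <- s) B p.1 p.2.
Proof.
have [Br Bl] := B_bil => ts; apply/eqP; rewrite -subr_eq0 -sumrN; apply/eqP.
(* Negated first legs turn the difference of two sums into the sum over a single list, as [bil_form]
   requires. *)
have -> : \sum_(p <- s) - B p.1 p.2 = \sum_(p <- [seq (- q.1, q.2) | q <- s]) B p.1 p.2.
  rewrite big_map; apply: eq_bigr => p _ /=.
  by rewrite -[in RHS]scaleN1r (linZ (Bl _)) scaleN1r.
rewrite -big_cat; apply: bil_form => //; apply/funext => f; apply/funext => g.
rewrite /tform big_cat big_map /= -/(tform (rep t) f g) -rep_form ts.
rewrite -big_split big1 // => p _ /=.
by rewrite linearN mulNr subrr.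
Qed.

Lemma tfold_lin : lin (tfold B).
Proof.
have [_ Bl] := B_bil => k t t'.
rewrite (@tfold_form _ ([seq (k *: p.1, p.2) | p <- rep t] ++ rep t')).
  rewrite big_cat big_map /=; congr (_ + _).
  by rewrite /tfold scaler_sumr; apply: eq_bigr => p _; apply: (linZ (Bl _)).
apply/funext => f; apply/funext => g; rewrite /tform big_cat big_map /=.
rewrite [LHS]ten_valP !rep_form; congr (_ + _).
rewrite /tform big_distrr /=.
by apply: eq_bigr => p _; rewrite linearZ mulrA.
Qed.

Lemma tfold_tn u v : tfold B (tn u v) = B u v.
Proof. by rewrite (@tfold_form _ [:: (u, v)]) // big_seq1. Qed.

End TFold.

Lemma bil_tn : bil tn.
Proof.
split=> [u|v] k w w'; apply/val_inj; rewrite val_tenP; apply/funext => f;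
  apply/funext => g.
  rewrite [RHS](_ : _ = k * tform [:: (u, w)] f g + tform [:: (u, w')] f g) //.
  by rewrite /= /tform !big_seq1 /= linearP mulrDr mulrCA.
rewrite [RHS](_ : _ = k * tform [:: (w, v)] f g + tform [:: (w', v)] f g) //.
by rewrite /= /tform !big_seq1 /= linearP mulrDl mulrA.
Qed.

Lemma rep_tn (t : ten) : t = \sum_(p <- rep t) tn p.1 p.2.
Proof.
apply/val_inj; rewrite rep_form; elim: (rep t) => [|p s IH].
  rewrite big_nil linear0; apply/funext => f; apply/funext => g.
  by rewrite /tform big_nil.
rewrite big_cons; apply/funext => f; apply/funext => g.
rewrite [RHS](_ : _ = tform [:: (p.1, p.2)] f g
                      + val (\sum_(p <- s) tn p.1 p.2) f g) // -IH.
by rewrite /tform big_cons big_seq1.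
Qed.

Lemma lin_ten_ext (X : lmodType K) (f g : ten -> X) : lin f -> lin g ->
  (forall u v, f (tn u v) = g (tn u v)) -> f =1 g.
Proof.
move=> fl gl fg t; rewrite (rep_tn t) (lin_sum fl) (lin_sum gl).
by apply: eq_bigr => p _; apply: fg.
Qed.

Lemma eq_tfold (X : lmodType K) (B B' : U -> V -> X) t :
  (forall u v, B u v = B' u v) -> tfold B t = tfold B' t.
Proof. by move=> BB'; apply: eq_bigr => p _; apply: BB'. Qed.

Lemma tfold_id t : tfold tn t = t. Proof. by rewrite [RHS]rep_tn. Qed.

Lemma lin_tfold (X Y : lmodType K) (h : X -> Y) (B : U -> V -> X) t :
  lin h -> h (tfold B t) = tfold (fun u v => h (B u v)) t.
Proof. by move=> hl; rewrite /tfold (lin_sum hl). Qed.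

Lemma lin_tfold_param (W X : lmodType K) (B : W -> U -> V -> X) t :
  (forall u v, lin (fun w => B w u v)) -> lin (fun w => tfold (B w) t).
Proof. by move=> Bl; apply: lin_bigsum => p; apply: Bl. Qed.

Lemma lin_tfold_const (W X : lmodType K) (B : U -> V -> X) (f : W -> ten) :
  bil B -> lin f -> lin (fun w => tfold B (f w)).
Proof. by move=> Bb; apply: lin_comp; apply: tfold_lin. Qed.

End TensorProduct.

Lemma tfold_tfold (K : fieldType) (U V U' V' X : lmodType K) (B : U' -> V' -> X)
    (C : U -> V -> ten U' V') t :
  bil B -> tfold B (tfold C t) = tfold (fun u v => tfold B (C u v)) t.
Proof. by move=> Bb; rewrite (lin_tfold _ _ (tfold_lin Bb)). Qed.

Lemma tfold_exchange (K : fieldType) (U V U' V' X : lmodType K)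
    (B : U -> V -> U' -> V' -> X) t t' :
  tfold (fun u v => tfold (B u v) t') t = tfold (fun u' v' => tfold (fun u v => B u v u' v') t) t'.
Proof. by rewrite /tfold exchange_big. Qed.

(** * Slicing, flipping and cancelling a leg *)

Section Cancellation.
Variables (K : fieldType) (U V : lmodType K).

Lemma lin_tn (t : ten U V) (f : {scalar U}) (g : {scalar V}) :
  val t f g = f (tfold (fun u v => (g v : K) *: u) t).
Proof.
rewrite rep_form /tform linear_sum; apply: eq_bigr => p _.
by rewrite linearZ mulrC.
Qed.

Lemma scalar_lin (g : {scalar V}) : lin (g : V -> K^o).
Proof. by move=> k u v; rewrite linearP. Qed.

Lemma ten_sep_l (t t' : ten U V) :
  (forall g : {scalar V}, tfold (fun u v => (g v : K) *: u) t
                       = tfold (fun u v => (g v : K) *: u) t') -> t = t'.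
Proof.
move=> tt'; apply/val_inj; apply/funext => f; apply/funext => g.
by rewrite !lin_tn tt'.
Qed.

End Cancellation.

Section Flip.
Variables (K : fieldType) (U V : lmodType K).

Definition flip (t : ten U V) : ten V U := tfold (fun u v => tn v u) t.

Lemma bil_flip : bil (fun (u : U) (v : V) => tn v u).
Proof. by split => [u|v] k x y; [apply: (bil_tn _ _).2|apply: (bil_tn _ _).1]. Qed.

Lemma flip_lin : lin flip. Proof. exact: tfold_lin bil_flip. Qed.

Lemma flip_tn u v : flip (tn u v) = tn v u. Proof. exact: tfold_tn bil_flip _ _. Qed.

End Flip.

Lemma flipK (K : fieldType) (U V : lmodType K) : cancel (@flip K U V) (@flip K V U).
Proof.
apply: lin_ten_ext => [||u v]; [|exact: lin_id|by rewrite !flip_tn].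
by apply: lin_comp; apply: flip_lin.
Qed.

Lemma tfold_flip (K : fieldType) (U V X : lmodType K) (B : V -> U -> X) (t : ten U V) :
  bil B -> tfold B (flip t) = tfold (fun u v => B v u) t.
Proof. by move=> Bb; rewrite tfold_tfold //; apply: eq_tfold => u v; apply: tfold_tn. Qed.

Section Cancellation2.
Variables (K : fieldType) (U V U' : lmodType K).

(** Slicing the second leg by a functional commutes with [L i] on the first, so the slices agree
    after every [L i], and these maps have no common kernel. *)
Lemma cancel1 (I : Type) (L : I -> U -> U') (t t' : ten U V) :
  (forall i, lin (L i)) -> (forall u, (forall i, L i u = 0) -> u = 0) ->
  (forall i, tfold (fun u v => tn (L i u) v) t = tfold (fun u v => tn (L i u) v) t') ->
  t = t'.
Proof.
move=> Ll L0 tt'; apply: ten_sep_l => g; apply/eqP; rewrite -subr_eq0; apply/eqP/L0 => i.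
rewrite (linB (Ll i)) !(lin_tfold _ _ (Ll i)).
have Bb : bil (fun (u : U') (v : V) => (g v : K) *: u).
  split => [u|v]; first exact/lin_scalel/scalar_lin.
  exact/lin_scale/lin_id.
have E s : tfold (fun u v => L i ((g v : K) *: u)) s =
           tfold (fun u v => (g v : K) *: u) (tfold (fun u v => tn (L i u) v) s).
  by rewrite tfold_tfold //; apply: eq_tfold => u v; rewrite tfold_tn // (linZ (Ll i)).
by rewrite !E tt' subrr.
Qed.

End Cancellation2.

Lemma cancel2 (K : fieldType) (U V V' : lmodType K) (I : Type) (L : I -> V -> V')
    (t t' : ten U V) :
  (forall i, lin (L i)) -> (forall v, (forall i, L i v = 0) -> v = 0) ->
  (forall i, tfold (fun u v => tn u (L i v)) t = tfold (fun u v => tn u (L i v)) t') ->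
  t = t'.
Proof.
move=> Ll L0 tt'; apply: (can_inj (@flipK _ _ _)); apply: (cancel1 Ll L0) => i.
have Bb : bil (fun v (u : U) => tn (L i v) u).
  by split => [v|u]; [apply: (bil_tn _ _).1|apply: lin_bill; [apply: bil_tn|]].
have := congr1 (@flip _ _ _) (tt' i); rewrite !(lin_tfold _ _ (@flip_lin _ _ _)) !tfold_flip //.
by under eq_tfold do rewrite flip_tn; move=> ->; apply: eq_tfold => u v; rewrite flip_tn.
Qed.

Lemma tfold_fuse (K : fieldType) (U V U1 V1 X : lmodType K) (B : U -> V -> X)
    (f : U1 -> V1 -> U) (g : U1 -> V1 -> V) t : bil B ->
  tfold B (tfold (fun p q => tn (f p q) (g p q)) t) = tfold (fun p q => B (f p q) (g p q)) t.
Proof. by move=> Bb; rewrite tfold_tfold //; apply: eq_tfold => p q; rewrite tfold_tn. Qed.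

(** * Trilinear maps and the automation of linearity *)

Definition tril (K : fieldType) (U V W X : lmodType K) (B : U -> V -> W -> X) :=
  [/\ forall v w, lin (fun u => B u v w), forall u w, lin (fun v => B u v w) &
      forall u v, lin (B u v)].

Section Trilinear.
Variables (K : fieldType) (U V W X : lmodType K) (B : U -> V -> W -> X).
Hypothesis B_tril : tril B.

Lemma tril12 w : bil (fun u v => B u v w).
Proof. by have [Bu Bv Bw] := B_tril; split=> [u|v]; [apply: Bv|apply: Bu]. Qed.

Lemma bil_tfold12 : bil (fun (t : ten U V) w => tfold (fun u v => B u v w) t).
Proof.
have [Bu Bv Bw] := B_tril; split=> [t|w]; last exact/tfold_lin/tril12.
by apply: lin_tfold_param => u v; apply: Bw.
Qed.

Lemma tfold3_fuse (U1 V1 U2 V2 : lmodType K) (f : U1 -> V1 -> U2 -> V2 -> U)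
    (g : U1 -> V1 -> U2 -> V2 -> V) (h : U1 -> V1 -> U2 -> V2 -> W)
    (s : U1 -> V1 -> ten U2 V2) (t : ten U1 V1) :
  tfold (fun (r : ten U V) w => tfold (fun u v => B u v w) r)
    (tfold (fun p q => tfold (fun x y => tn (tn (f p q x y) (g p q x y)) (h p q x y)) (s p q)) t) =
  tfold (fun p q => tfold (fun x y => B (f p q x y) (g p q x y) (h p q x y)) (s p q)) t.
Proof.
rewrite tfold_tfold; last exact: bil_tfold12; apply: eq_tfold => p q.
rewrite tfold_tfold; last exact: bil_tfold12; apply: eq_tfold => x y.
by rewrite !tfold_tn //; [apply: tril12|apply: bil_tfold12].
Qed.

End Trilinear.

Create HintDb bilin.
#[export] Hint Resolve bil_tn bil_flip lin_id lin_zero flip_lin : bilin.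

(** Recursion on the λ-term, with the facts in [bilin] as leaves. The variable may enter a [tfold]
    through the tensor or through the summand; both are tried. *)
Ltac linear :=
  cbv beta; lazymatch goal with
  | |- tril _ => split; intros; linear
  | |- bil _ =>
      first [ solve [auto 2 with bilin nocore] | split; intros; linear ]
  | |- lin _ =>
      first [ solve [auto 2 with bilin nocore] |
      lazymatch goal with
      | |- lin (tfold _) => apply: tfold_lin; linear
      | |- lin (fun x => tfold (@?B x) (@?t x)) =>
          first [ apply: (@lin_tfold_const _ _ _ _ _ _ t); [linear | linear]
                | apply: (@lin_tfold_param _ _ _ _ _ B _); intros; linear ]
      | |- lin (fun x => \sum_(_ <- _) _) => apply: lin_bigsum; intros; linear
      | |- lin (fun x => @?c x *: @?f x) =>
          first [ apply: (@lin_scale _ _ _ _ f); linear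
                | apply: (@lin_scalel _ _ _ c _); linear ]
      | |- lin (fun x => @?f x + @?g x) => apply: (@lin_add _ _ _ f g); linear
      | |- lin (fun x => ?B (@?u x) (@?f x)) =>
          first [ apply: (@lin_bilr _ _ _ _ _ B _ f); [linear | linear]
                | apply: (@lin_bill _ _ _ _ _ B _ u); [linear | linear] ]
      | |- lin (fun x => ?g (@?f x)) =>
          apply: (@lin_comp _ _ _ _ g f); linear
      | |- lin (?B ?u) => apply: (@lin_bilr _ _ _ _ _ B u id); linear
      end ]
  end.

Lemma lin_inverse (K : fieldType) (U V : lmodType K) (f : U -> V) : lin f ->
  injective f -> (forall v, exists u, f u = v) ->
  exists g : V -> U, [/\ lin g, cancel g f & cancel f g].
Proof.
move=> fl finj fsurj; pose g v := proj1_sig (cid (fsurj v)).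
have gK : cancel g f by move=> v; apply: (proj2_sig (cid (fsurj v))).
exists g; split=> // [k u v|u]; apply: finj; last by rewrite gK.
by rewrite fl !gK.
Qed.

(** When a canonical map is onto, the covered coproducts span the tensor product; a bilinear
    identity can then be tested on them, where the rules for counit, antipode and integral apply. *)
Lemma span_eq (K : fieldType) (U V U' V' X : lmodType K) (d : U -> V -> ten U' V')
    (B B' : U' -> V' -> X) :
  (forall t, exists u, tfold d u = t) -> bil B -> bil B' ->
  (forall u v, tfold B (d u v) = tfold B' (d u v)) -> forall p q, B p q = B' p q.
Proof.
move=> d_surj Bb Bb' BB' p q; have [u du] := d_surj (tn p q).
rewrite -(tfold_tn Bb) -(tfold_tn Bb') -du !tfold_tfold //; exact: eq_tfold.
Qed.

Lemma tfold_lin_tn (K : fieldType) (U V X : lmodType K) (h : ten U V -> X) t :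
  lin h -> tfold (fun u v => h (tn u v)) t = h t.
Proof. by move=> hl; rewrite -(lin_tfold _ _ hl) tfold_id. Qed.

Section TnLinearity.
Variables (K : fieldType) (U V : lmodType K).

Lemma tnZl k (u : U) (v : V) : tn (k *: u) v = k *: tn u v.
Proof. exact: linZ ((bil_tn _ _).2 v) k u. Qed.

Lemma tnZr k (u : U) (v : V) : tn u (k *: v) = k *: tn u v.
Proof. exact: linZ ((bil_tn _ _).1 u) k v. Qed.

Variables U1 V1 : lmodType K.

Lemma tn_tfoldl (B : U1 -> V1 -> U) t (v : V) :
  tn (tfold B t) v = tfold (fun p q => tn (B p q) v) t.
Proof. exact: lin_tfold ((bil_tn _ _).2 v). Qed.

Lemma tn_tfoldr (B : U1 -> V1 -> V) t (u : U) :
  tn u (tfold B t) = tfold (fun p q => tn u (B p q)) t.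
Proof. exact: lin_tfold ((bil_tn _ _).1 u). Qed.

Lemma scale_tfold (B : U1 -> V1 -> U) t (k : K) :
  k *: tfold B t = tfold (fun p q => k *: B p q) t.
Proof. by apply: lin_tfold; apply/lin_scale/lin_id. Qed.

End TnLinearity.

Lemma ten_ind (K : fieldType) (U V : lmodType K) (P : ten U V -> Prop) :
  P 0 -> (forall t t', P t -> P t' -> P (t + t')) -> (forall u v, P (tn u v)) ->
  forall t, P t.
Proof. by move=> P0 PD Ptn t; rewrite [t]rep_tn; apply: big_ind. Qed.

(** * Regular multiplier Hopf algebras through covered coproducts *)

Section CoveredCoproduct.
Variables (K : fieldType) (A : lmodType K) (mul : A -> A -> A).
Local Notation "a ** b" := (mul a b) (at level 40, left associativity).

Hypothesis mul_bil : bil mul.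
Hypothesis mulA : forall a b c, a ** (b ** c) = a ** b ** c.
Hypothesis ndl : forall a, (forall b, a ** b = 0) -> a = 0.
Hypothesis ndr : forall a, (forall b, b ** a = 0) -> a = 0.
#[local] Hint Resolve mul_bil : bilin.

Section Cancel.
Variable U : lmodType K.

Lemma canc_l1 (t t' : ten A U) :
  (forall c, tfold (fun p q => tn (c ** p) q) t = tfold (fun p q => tn (c ** p) q) t') -> t = t'.
Proof. by apply: (@cancel1 _ _ _ _ _ mul) => [c|]; [linear|apply: ndr]. Qed.

Lemma canc_l2 (t t' : ten U A) :
  (forall c, tfold (fun p q => tn p (c ** q)) t = tfold (fun p q => tn p (c ** q)) t') -> t = t'.
Proof. by apply: (@cancel2 _ _ _ _ _ mul) => [c|]; [linear|apply: ndr]. Qed.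

Lemma canc_r2 (t t' : ten U A) :
  (forall c, tfold (fun p q => tn p (q ** c)) t = tfold (fun p q => tn p (q ** c)) t') -> t = t'.
Proof. by apply: (@cancel2 _ _ _ _ _ (fun c p => p ** c)) => [c|]; [linear|apply: ndl]. Qed.

End Cancel.

(* In Sweedler notation  d1 a b = a_1 ⊗ a_2 b,  d2 a b = a b_1 ⊗ b_2,
   d3 a b = a_1 b ⊗ a_2  and  d4 a b = b_1 ⊗ a b_2. *)
Variables d1 d2 d3 d4 : A -> A -> ten A A.
Hypothesis d1_bil : bil d1.
Hypothesis d2_bil : bil d2.
Hypothesis d3_bil : bil d3.
Hypothesis d4_bil : bil d4.
#[local] Hint Resolve d1_bil d2_bil d3_bil d4_bil : bilin.

(** The four relations tie the covers to one and the same Δ(a); here c a_1 ⊗ a_2 b is read in two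
    ways. *)
Hypothesis d12 : forall a b c,
  tfold (fun p q => tn (c ** p) q) (d1 a b) = tfold (fun p q => tn p (q ** b)) (d2 c a).
Hypothesis d32 : forall a b c,
  tfold (fun p q => tn (c ** p) q) (d3 a b) = tfold (fun p q => tn (p ** b) q) (d2 c a).
Hypothesis d14 : forall a b c,
  tfold (fun p q => tn p (c ** q)) (d1 a b) = tfold (fun p q => tn p (q ** b)) (d4 c a).
Hypothesis d34 : forall a b c,
  tfold (fun p q => tn p (c ** q)) (d3 a b) = tfold (fun p q => tn (p ** b) q) (d4 c a).
Hypothesis d1M : forall a b c,
  d1 (a ** b) c = tfold (fun m n => tfold (fun p q => tn (p ** m) q) (d1 a n)) (d1 b c).
Hypothesis coassoc12 : forall a b c,
  tfold (fun p r => tfold (fun x y => tn (tn x y) r) (d2 a p)) (d1 b c) =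
  tfold (fun p q => tfold (fun y z => tn (tn p y) z) (d1 q c)) (d2 a b).

Lemma tfold_map (U V U1 V1 U2 V2 X : lmodType K) (B : U -> V -> X)
    (f1 : U1 -> V1 -> U) (g1 : U1 -> V1 -> V) (f2 : U2 -> V2 -> U) (g2 : U2 -> V2 -> V) t t' :
  bil B ->
  tfold (fun p q => tn (f1 p q) (g1 p q)) t = tfold (fun p q => tn (f2 p q) (g2 p q)) t' ->
  tfold (fun p q => B (f1 p q) (g1 p q)) t = tfold (fun p q => B (f2 p q) (g2 p q)) t'.
Proof.
by move=> Bb /(congr1 (tfold B)); rewrite !tfold_fuse.
Qed.

Section Exchange.
Variables (X : lmodType K) (B : A -> A -> X).
Hypothesis B_bil : bil B.

Lemma E12 a b c :
  tfold (fun p q => B (c ** p) q) (d1 a b) = tfold (fun p q => B p (q ** b)) (d2 c a).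
Proof. exact: tfold_map (d12 a b c). Qed.

Lemma E32 a b c :
  tfold (fun p q => B (c ** p) q) (d3 a b) = tfold (fun p q => B (p ** b) q) (d2 c a).
Proof. exact: tfold_map (d32 a b c). Qed.

Lemma E14 a b c :
  tfold (fun p q => B p (c ** q)) (d1 a b) = tfold (fun p q => B p (q ** b)) (d4 c a).
Proof. exact: tfold_map (d14 a b c). Qed.

Lemma E34 a b c :
  tfold (fun p q => B p (c ** q)) (d3 a b) = tfold (fun p q => B (p ** b) q) (d4 c a).
Proof. exact: tfold_map (d34 a b c). Qed.

End Exchange.

Lemma d13 a b c :
  tfold (fun p q => tn (p ** c) q) (d1 a b) = tfold (fun p q => tn p (q ** b)) (d3 a c).
Proof.
apply: canc_l1 => e; rewrite !tfold_fuse; try linear.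
under eq_tfold do rewrite mulA.
rewrite (@E12 _ (fun p q => tn (p ** c) q)); last by linear.
by rewrite (@E32 _ (fun p q => tn p (q ** b))); last by linear.
Qed.

Lemma E13 (X : lmodType K) (B : A -> A -> X) a b c : bil B ->
  tfold (fun p q => B (p ** c) q) (d1 a b) = tfold (fun p q => B p (q ** b)) (d3 a c).
Proof. by move=> Bb; apply: tfold_map (d13 a b c). Qed.

Lemma d1Mr a b c : d1 a (b ** c) = tfold (fun p q => tn p (q ** c)) (d1 a b).
Proof.
apply: canc_l1 => e; rewrite !tfold_fuse; try linear.
rewrite (@E12 _ (@tn K A A)) ?(@E12 _ (fun p q => tn p (q ** c))); try linear.
by apply: eq_tfold => p q; rewrite mulA.
Qed.

Lemma d3Mr a b c : d3 a (b ** c) = tfold (fun p q => tn (p ** c) q) (d3 a b).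
Proof.
apply: canc_l1 => e; rewrite !tfold_fuse; try linear.
under [RHS]eq_tfold do rewrite mulA.
rewrite (@E32 _ (@tn K A A)) ?(@E32 _ (fun p q => tn (p ** c) q)); try linear.
by apply: eq_tfold => p q; rewrite mulA.
Qed.

Lemma d3M a b c :
  d3 (a ** b) c = tfold (fun m n => tfold (fun p q => tn (p ** m) q) (d1 a n)) (d3 b c).
Proof.
apply: canc_r2 => e; rewrite tfold_tfold; last by linear.
rewrite -(@E13 _ (@tn K A A)); last by linear.
rewrite d1M tfold_tfold; last by linear.
under eq_tfold do (rewrite tfold_fuse; last by linear).
under eq_tfold do under eq_tfold do rewrite -mulA.
rewrite (@E13 _ (fun m n => tfold (fun p q => tn (p ** m) q) (d1 a n))); last by linear.
by apply: eq_tfold => m n; rewrite d1Mr !tfold_fuse; try linear.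
Qed.

(** * Coassociativity under various covers *)

Section Coassociativity.
Variables (X : lmodType K) (B : A -> A -> A -> X).
Hypothesis B_tril : tril B.

Lemma C12 a b c :
  tfold (fun p r => tfold (fun x y => B x y r) (d2 a p)) (d1 b c) =
  tfold (fun p q => tfold (fun y z => B p y z) (d1 q c)) (d2 a b).
Proof.
have /(congr1 (tfold (fun (u : ten A A) z => tfold (fun x y => B x y z) u))) := coassoc12 a b c.
by rewrite !tfold3_fuse.
Qed.

End Coassociativity.

Lemma ten3_canc1 (t t' : ten (ten A A) A) :
  (forall c, tfold (fun (u : ten A A) z => tfold (fun x y => tn (tn (c ** x) y) z) u) t =
             tfold (fun (u : ten A A) z => tfold (fun x y => tn (tn (c ** x) y) z) u) t') ->
  t = t'.
Proof.
move=> tt'; apply: (@cancel1 _ _ _ _ _ (fun c => tfold (fun x y => tn (c ** x) y))).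
- by move=> c; linear.
- move=> u u0; apply: canc_l1 => c; rewrite u0.
  by rewrite (lin0 (tfold_lin _)) //; linear.
move=> c; have E s : tfold (fun u z => tn (tfold (fun x y => tn (c ** x) y) u) z) s =
    tfold (fun (u : ten A A) z => tfold (fun x y => tn (tn (c ** x) y) z) u) s.
  apply: eq_tfold => u z.
  by rewrite (@lin_tfold _ _ _ _ _ (fun u => tn u z)) //; linear.
by rewrite !E.
Qed.

Lemma ten3_canc3 (t t' : ten (ten A A) A) :
  (forall c, tfold (fun (u : ten A A) z => tfold (fun x y => tn (tn x y) (z ** c)) u) t =
             tfold (fun (u : ten A A) z => tfold (fun x y => tn (tn x y) (z ** c)) u) t') ->
  t = t'.
Proof.
move=> tt'; apply: canc_r2 => c.
have E s : tfold (fun u z => tn u (z ** c)) s =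
    tfold (fun (u : ten A A) z => tfold (fun x y => tn (tn x y) (z ** c)) u) s.
  apply: eq_tfold => u z.
  rewrite -{1}[u]tfold_id (@lin_tfold _ _ _ _ _ (fun u => tn u (z ** c))) //; linear.
by rewrite !E.
Qed.

(** Both sides are b_1 e ⊗ b_2 ⊗ b_3 c. A further factor on the left of the first leg lets [d2]
    replace [d3], which leads back to [coassoc12]. *)
Lemma coassoc31 b e c :
  tfold (fun p q => tfold (fun y z => tn (tn p y) z) (d1 q c)) (d3 b e) =
  tfold (fun p r => tfold (fun x y => tn (tn x y) r) (d3 p e)) (d1 b c).
Proof.
apply: ten3_canc1 => a; rewrite !tfold3_fuse; try linear.
rewrite (@E32 _ (fun p q => tfold (fun y z => tn (tn p y) z) (d1 q c))); last by linear.
have /= <- := @C12 _ (fun p y z => tn (tn (p ** e) y) z) _ a b c; last by linear.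
apply: eq_tfold => p r.
by rewrite (@E32 _ (fun x y => tn (tn x y) r)) //; linear.
Qed.

Lemma C31 (X : lmodType K) (B : A -> A -> A -> X) b e c : tril B ->
  tfold (fun p q => tfold (fun y z => B p y z) (d1 q c)) (d3 b e) =
  tfold (fun p r => tfold (fun x y => B x y r) (d3 p e)) (d1 b c).
Proof.
move=> Bt.
have /(congr1 (tfold (fun (u : ten A A) z => tfold (fun x y => B x y z) u))) := coassoc31 b e c.
by rewrite !tfold3_fuse.
Qed.

(** Both sides are x_1 y ⊗ x_2 ⊗ d x_3. A further factor on the right of the last leg lets [d1]
    replace [d4]. *)
Lemma coassoc34 x y d :
  tfold (fun p q => tfold (fun m n => tn (tn p m) n) (d4 d q)) (d3 x y) =
  tfold (fun q n => tfold (fun p m => tn (tn p m) n) (d3 q y)) (d4 d x).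
Proof.
apply: ten3_canc3 => c; rewrite !tfold3_fuse; try linear.
rewrite -(@E14 _ (fun q n => tfold (fun p m => tn (tn p m) n) (d3 q y))); last by linear.
rewrite -(@C31 _ (fun p m n => tn (tn p m) (d ** n))); last by linear.
apply: eq_tfold => p q.
by rewrite (@E14 _ (fun m n => tn (tn p m) n)) //; linear.
Qed.

Lemma C34 (X : lmodType K) (B : A -> A -> A -> X) x y d : tril B ->
  tfold (fun p q => tfold (fun m n => B p m n) (d4 d q)) (d3 x y) =
  tfold (fun q n => tfold (fun p m => B p m n) (d3 q y)) (d4 d x).
Proof.
move=> Bt.
have /(congr1 (tfold (fun (u : ten A A) z => tfold (fun x y => B x y z) u))) := coassoc34 x y d.
by rewrite !tfold3_fuse.
Qed.

(** Both sides apply [B] to a_1 ⊗ a_2 g_1 ⊗ a_3 g_2 h: this is the pentagon relation T_23 T_12 =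
    T_12 T_13 T_23 for T(a ⊗ b) = Δ(a)(1 ⊗ b). *)
Lemma pentagon (X : lmodType K) (B : A -> A -> A -> X) a g h : tril B ->
  tfold (fun y z => tfold (fun m n => B y m n) (d1 z h)) (d1 a g) =
  tfold (fun m n => tfold (fun c n' => tfold (fun c1 c2 => B c1 c2 n') (d1 c m)) (d1 a n))
    (d1 g h).
Proof.
move=> Bt; pose B' := fun (r : ten A A) w => tfold (fun u v => B u v w) r.
have B'b : bil B' by apply: bil_tfold12.
transitivity (tfold B' (tfold (fun m n => tfold (fun c n' =>
    tfold (fun c1 c2 => tn (tn c1 c2) n') (d1 c m)) (d1 a n)) (d1 g h))); last first.
  rewrite tfold_tfold //; apply: eq_tfold => m n; exact: tfold3_fuse.
transitivity (tfold B' (tfold (fun y z => tfold (fun m n => tn (tn y m) n) (d1 z h)) (d1 a g))).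
  by rewrite [RHS]tfold3_fuse.
congr (tfold _ _); apply: ten3_canc1 => d; rewrite tfold3_fuse; last by linear.
rewrite tfold_tfold; last by linear.
under [RHS]eq_tfold do (rewrite tfold3_fuse; last by linear).
rewrite (@E12 _ (fun y z => tfold (fun m n => tn (tn y m) n) (d1 z h))); last by linear.
under eq_tfold do (rewrite d1M tfold_tfold; last by linear).
rewrite tfold_exchange; apply: eq_tfold => m n.
under [RHS]eq_tfold do
  (rewrite (@E12 _ (fun c1 c2 => tn (tn c1 c2) _)); last by linear).
rewrite (@C12 _ (fun c1 c2 n' => tn (tn c1 (c2 ** m)) n')); last by linear.
by apply: eq_tfold => y w; rewrite tfold_fuse //; linear.
Qed.

(** * Counit and inverse antipode *)

Hypothesis T1_inj : injective (tfold d1).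
Hypothesis T1_surj : forall t, exists u, tfold d1 u = t.
Hypothesis T2_surj : forall t, exists u, tfold d2 u = t.
Hypothesis T3_inj : injective (tfold d3).
Hypothesis T3_surj : forall t, exists u, tfold d3 u = t.

(** Undoing T1 and multiplying gives [E] with E(x_1, x_2 y) = x y, which ought to be E(q, c) = ε(q)
    c. The relation a b_1 ⊗ E(b_2, c) = a b ⊗ c forces each E(q, ·) to be a scalar. *)
Lemma counit_exists (p0 : A) : p0 != 0 -> exists eps : A -> K^o,
  [/\ lin eps, forall x y, tfold (fun p q => eps p *: q) (d1 x y) = x ** y &
      forall x y, tfold (fun p q => eps q *: p) (d2 x y) = x ** y].
Proof.
move=> /separating_functional [f0 f0p].
have f0_lin : lin (f0 : A -> K^o) by apply: scalar_lin.
have [J [Jl JK KJ]] := lin_inverse (tfold_lin d1_bil) T1_inj T1_surj.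
pose E b c := tfold mul (J (tn b c)).
have E_bil : bil E.
  by rewrite /E; linear.
have Ed1 x y : tfold E (d1 x y) = x ** y.
  rewrite (@tfold_lin_tn _ _ _ _ (fun t => tfold mul (J t))); last first.
    by apply: (@lin_comp _ _ _ _ (tfold mul)); linear.
  by rewrite -[d1 x y](tfold_tn d1_bil) KJ tfold_tn.
have key a b c : tfold (fun p q => tn p (E q c)) (d2 a b) = tn (a ** b) c.
  move: b c; apply: (span_eq T1_surj); [by linear|by linear|] => x y.
  rewrite (@C12 _ (fun p q r => tn p (E q r))); last by linear.
  rewrite (@E12 _ (@tn _ _ _)); last by linear.
  apply: eq_tfold => p q; rewrite -Ed1 (@lin_tfold _ _ _ _ _ (tn p)) //; linear.
pose eps q : K^o := f0 (E q p0).
have E_eps q c : E q c = (eps q : K) *: c.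
  (* Since p0 ⊗ q is a combination of elements a b_1 ⊗ b_2, [key] gives p0 ⊗ E(q, c') = v' ⊗ c' with
     v' independent of c'; [f0] then removes the first leg. *)
  have [v dv] := T2_surj (tn p0 q).
  have {}key c' : tn p0 (E q c') = tn (tfold mul v) c'.
    transitivity (tfold (fun p q => tn p (E q c')) (tfold d2 v)).
      by rewrite dv tfold_tn //; linear.
    rewrite tfold_tfold; last by linear.
    under eq_tfold do rewrite key.
    by rewrite (@lin_tfold _ _ _ _ _ (fun z => tn z c')) //; linear.
  have fbil : bil (fun (p q : A) => (f0 p : K) *: q).
    by split=> u; [exact/lin_scale/lin_id|exact/lin_scalel].
  have {}key c' : E q c' = (f0 (tfold mul v) : K) *: c'.
    have := congr1 (tfold (fun (p q : A) => (f0 p : K) *: q)) (key c').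
    by rewrite !tfold_tn // f0p scale1r.
  by rewrite /eps !key linearZ /= f0p mulr1.
exists eps; split=> [|x y|x y].
- by apply: (@lin_comp _ _ _ _ (f0 : A -> K^o)) => //; linear.
- by rewrite -Ed1; apply: eq_tfold => p q; rewrite E_eps.
have f0bil : bil (fun (p q : A) => (f0 q : K) *: p).
  by split=> u; [exact/lin_scalel|exact/lin_scale/lin_id].
have := congr1 (tfold (fun (p q : A) => (f0 q : K) *: p)) (key x y p0).
rewrite tfold_fuse // tfold_tn // f0p scale1r => <-; apply: eq_tfold => p q.
by rewrite E_eps linearZ /= f0p mulr1.
Qed.

Section Counit.
Variable eps : A -> K^o.
Hypothesis eps_lin : lin eps.
Hypothesis eps1 : forall x y, tfold (fun p q => eps p *: q) (d1 x y) = x ** y.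
#[local] Hint Resolve eps_lin : bilin.

Hypothesis eps2 : forall x y, tfold (fun p q => eps q *: p) (d2 x y) = x ** y.

Lemma eps4 x y : tfold (fun p q => eps p *: q) (d4 x y) = x ** y.
Proof.
apply/eqP; rewrite -subr_eq0; apply/eqP/ndl => c.
rewrite (linB (mul_bil.2 c)) (@lin_tfold _ _ _ _ _ (fun z => z ** c)); last by linear.
have Zmul k p : (k *: p) ** c = k *: (p ** c) by apply: linZ (mul_bil.2 c) k p.
under eq_tfold do rewrite Zmul.
rewrite -(@E14 _ (fun p q => eps p *: q)); last by linear.
have mulZ k p : x ** (k *: p) = k *: (x ** p) by apply: linZ (mul_bil.1 x) k p.
under eq_tfold do rewrite -mulZ.
by rewrite -(@lin_tfold _ _ _ _ _ (mul x)) ?eps1 ?mulA ?subrr //; linear.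
Qed.

Lemma d2M e v w :
  d2 e (v ** w) = tfold (fun p q => tfold (fun m n => tn m (q ** n)) (d2 p w)) (d2 e v).
Proof.
apply: canc_r2 => c; rewrite -(@E12 _ (@tn _ _ _)); last by linear.
rewrite d1M !tfold_tfold; try linear.
under eq_tfold do (rewrite tfold_fuse; last by linear).
under [RHS]eq_tfold do (rewrite tfold_fuse; last by linear).
under eq_tfold do under eq_tfold do rewrite mulA.
under eq_tfold do (rewrite (@E12 _ (fun p q => tn (p ** _) q)); last by linear).
under [RHS]eq_tfold do under eq_tfold do rewrite -mulA.
under [RHS]eq_tfold do (rewrite -(@E12 _ (fun m n => tn m (_ ** n))); last by linear).
by rewrite tfold_exchange.
Qed.

Variable p0 : A.
Hypothesis p0_neq0 : p0 != 0.

(** The identity ε(x n) m = ε(x) ε(n) m is tested on m ⊗ n = p z_1 ⊗ z_2. Both sides become ε(x) p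
    z, the left one by writing p ⊗ x as a combination of a b_1 ⊗ b_2 and using the counit at b z. *)
Lemma epsM x y : eps (x ** y) = (eps x : K) * (eps y : K).
Proof.
have Zmul k p c : (k *: p) ** c = k *: (p ** c) by apply: linZ (mul_bil.2 c) k p.
have epsl p q z : tfold (fun m n => eps (q ** n) *: m) (d2 p z) = eps q *: (p ** z).
  move: p q; apply: (span_eq T2_surj); [by linear|by linear|] => a b.
  rewrite -(@tfold_fuse _ _ _ _ _ _ (fun p q => eps q *: (p ** z)) (fun p q => p) (fun p q => q));
    last by linear.
  rewrite tfold_id; under [RHS]eq_tfold do rewrite -Zmul.
  rewrite -(@lin_tfold _ _ _ _ _ (fun u => u ** z)); last by linear.
  rewrite eps2 -mulA -eps2 d2M tfold_tfold; last by linear.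
  by apply: eq_tfold => p q; rewrite tfold_fuse //; linear.
have E (m n : A) : eps (x ** n) *: m = (eps x : K) *: (eps n *: m).
  move: m n; apply: (@span_eq _ _ _ _ _ _ d2 (fun m n => eps (x ** n) *: m)
    (fun m n => (eps x : K) *: (eps n *: m)) T2_surj); [by linear|by linear|] => p z.
  rewrite -(@lin_tfold _ _ _ _ _ (fun u => (eps x : K) *: u)); last exact/lin_scale/lin_id.
  by rewrite eps2 epsl.
have /eqP := E p0 y; rewrite scalerA -subr_eq0 -scalerBl scaler_eq0 (negPf p0_neq0) orbF.
by rewrite subr_eq0 => /eqP.
Qed.

(* [sigma] is the inverse antipode: it is determined by
   [sigma x_2 * (x_1 * y) = eps x * y]. *)
Lemma antipode_exists : exists sigma : A -> A,
  [/\ lin sigma, forall z, exists s, sigma s = z,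
      forall c d, sigma (c ** d) = sigma d ** sigma c &
      forall x y, tfold (fun p q => sigma q ** p) (d3 x y) = eps x *: y].
Proof.
have Zmul k p c : (k *: p) ** c = k *: (p ** c) by apply: linZ (mul_bil.2 c) k p.
have [J [Jl JK KJ]] := lin_inverse (tfold_lin d3_bil) T3_inj T3_surj.
(* [L q p] stands for σ(q) p; it is prescribed on the spanning elements x_1 y ⊗ x_2 by the value
   ε(x) y. *)
pose L q p := tfold (fun x y => eps x *: y) (J (tn p q)).
have L_bil : bil L.
  by rewrite /L; linear.
have Ld3 x y : tfold (fun p q => L q p) (d3 x y) = eps x *: y.
  rewrite (@tfold_lin_tn _ _ _ _ (fun t => tfold (fun x y => eps x *: y) (J t))); last first.
    by apply: (@lin_comp _ _ _ _ (tfold (fun x y => eps x *: y))); linear.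
  by rewrite -[d3 x y](tfold_tn d3_bil) KJ tfold_tn //; linear.
have LMr q p r : L q (p ** r) = L q p ** r.
  move: p q; apply: (@span_eq _ _ _ _ _ _ d3 (fun p q => L q (p ** r)) (fun p q => L q p ** r) T3_surj);
    [by linear|by linear|] => x y.
  rewrite -(@lin_tfold _ _ _ _ _ (fun z => z ** r)) ?Ld3 ?Zmul -?Ld3; last by linear.
  by rewrite d3Mr tfold_fuse //; linear.
(* Antimultiplicativity in disguise: σ(x_2 y) x_1 r = ε(x) σ(y) r. *)
have Ld1 x y r : tfold (fun p q => L q (p ** r)) (d1 x y) = eps x *: L y r.
  move: r y; apply: (@span_eq _ _ _ _ _ _ d3 (fun r y => tfold (fun p q => L q (p ** r)) (d1 x y))
    (fun r y => eps x *: L y r) T3_surj); [by linear|by linear|] => u v.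
  rewrite -(@lin_tfold _ _ _ _ _ (fun z : A => eps x *: z)) ?Ld3 ?scalerA -?epsM -?Ld3; last first.
    exact/lin_scale/lin_id.
  rewrite d3M tfold_tfold; last by linear.
  by apply: eq_tfold => m n; rewrite tfold_fuse //; linear.
have [x1 ex1] : exists x1, eps x1 = 1.
  case: (pselect (exists x, eps x != 0)) => [[x ex]|no].
    by exists ((eps x : K)^-1 *: x); rewrite (linZ eps_lin); apply: mulVf.
  have eps0 x : eps x = 0 by apply: contrapT => /eqP ex; apply: no; exists x.
  case/eqP: p0_neq0; apply: ndl => b; rewrite -eps1 /tfold big1 // => i _.
  by rewrite eps0 scale0r.
(* The expected identity σ(x_2 s) x_1 = ε(x) σ(s), read at an element with ε(x1) = 1, expresses σ(s)
   through [L] alone. *)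
pose sigma s := tfold (fun p q => L q p) (d1 x1 s).
have sigma_lin : lin sigma by rewrite /sigma; linear.
have sigmaE s r : L s r = sigma s ** r.
  rewrite /sigma (@lin_tfold _ _ _ _ _ (fun z => z ** r)); last by linear.
  by under [RHS]eq_tfold do rewrite -LMr; rewrite Ld1 ex1 scale1r.
(* Any sum of products σ(q) p is itself a value of σ, and z = ε(x1) z is such a sum. *)
have sigma_surj t : exists s, sigma s = tfold (fun p q => sigma q ** p) t.
  have [u <-] := T1_surj t; exists (tfold (fun x y => eps x *: y) u).
  have sb : bil (fun p q => sigma q ** p) by linear.
  rewrite tfold_tfold // (lin_tfold _ _ sigma_lin); apply: eq_tfold => x y.
  rewrite (linZ sigma_lin); apply/eqP; rewrite -subr_eq0; apply/eqP/ndl => r.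
  rewrite (linB (mul_bil.2 r)) Zmul -sigmaE -Ld1.
  rewrite (@lin_tfold _ _ _ _ _ (fun z => z ** r)); last by linear.
  by under [X in _ - X]eq_tfold do rewrite -mulA -sigmaE; rewrite subrr.
have sigma3 x y : tfold (fun p q => sigma q ** p) (d3 x y) = eps x *: y.
  by rewrite -Ld3; apply: eq_tfold => p q; rewrite sigmaE.
exists sigma; split=> // [z|c d].
  by have [s sz] := sigma_surj (d3 x1 z); exists s; rewrite sz sigma3 ex1 scale1r.
apply/eqP; rewrite -subr_eq0; apply/eqP/ndl => r.
rewrite (linB (mul_bil.2 r)) -mulA -!sigmaE.
suff -> : L (c ** d) r = L d (L c r) by rewrite subrr.
move: r c; apply: (@span_eq _ _ _ _ _ _ d3 (fun r c => L (c ** d) r)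
    (fun r c => L d (L c r)) T3_surj); [by linear|by linear|] => x y.
rewrite -(@lin_tfold _ _ _ _ _ (L d)) ?Ld3 ?(linZ (L_bil.1 d)) -?Ld1; last by linear.
by rewrite (@E13 _ (fun p q => L q p)) //; linear.
Qed.

End Counit.

(** * Consequences of left invariance *)

Section Antipode.
Variables (eps : A -> K^o) (sigma : A -> A).
Hypothesis eps_lin : lin eps.
Hypothesis eps4 : forall x y, tfold (fun p q => eps p *: q) (d4 x y) = x ** y.
Hypothesis sigma_lin : lin sigma.
Hypothesis sigma3 : forall x y, tfold (fun p q => sigma q ** p) (d3 x y) = eps x *: y.
#[local] Hint Resolve eps_lin sigma_lin : bilin.

(** The left side is σ(x_2) x_1 y ⊗ d x_3; coassociativity brings σ next to its partner, and the
    counit absorbs the resulting ε. *)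
Lemma sigma34 d x y :
  tfold (fun r q => tfold (fun m n => tn (sigma m ** r) n) (d4 d q)) (d3 x y) = tn y (d ** x).
Proof.
rewrite (@C34 _ (fun r m n => tn (sigma m ** r) n)); last by linear.
rewrite -eps4 (@lin_tfold _ _ _ _ _ (tn y)); last by linear.
apply: eq_tfold => p q.
rewrite -(@lin_tfold _ _ _ _ _ (fun z => tn z q)) ?sigma3; last by linear.
by rewrite (linZ ((bil_tn _ _).2 q)) (linZ ((bil_tn _ _).1 y)).
Qed.

Hypothesis sigmaM : forall c d, sigma (c ** d) = sigma d ** sigma c.
Variable phi : A -> K^o.
Hypothesis phi_lin : lin phi.
Hypothesis phi_inv : forall a b, tfold (fun p q => phi q *: p) (d3 a b) = phi a *: b.
#[local] Hint Resolve phi_lin : bilin.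

(* The strong left invariance of [phi], multiplied by [sigma a] on the left. *)
Lemma phi_strong_inv a b c :
  sigma a ** tfold (fun p q => phi q *: p) (d1 b c) =
  tfold (fun p q => phi (b ** q) *: sigma p) (d3 c a).
Proof.
have Zmul k p d : (k *: p) ** d = k *: (p ** d) by apply: linZ (mul_bil.2 d) k p.
have mulZ k p d : p ** (k *: d) = k *: (p ** d) by apply: linZ (mul_bil.1 p) k d.
apply/eqP; rewrite -subr_eq0; apply/eqP/ndl => d; rewrite (linB (mul_bil.2 d)).
apply/eqP; rewrite subr_eq0; apply/eqP; move: d c.
apply: (@span_eq _ _ _ _ _ _ d3 (fun d c => sigma a ** tfold (fun p q => phi q *: p) (d1 b c) ** d)
    (fun d c => tfold (fun p q => phi (b ** q) *: sigma p) (d3 c a) ** d) T3_surj);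
    [by linear|by linear|] => x y.
(* On d ⊗ c = x_1 y ⊗ x_2 both sides equal φ(b x) σ(a) y: the left one by invariance at b x, the
   right one because σ(x_2 a) = σ(a) σ(x_2) and σ(x_2) x_1 y ⊗ b x_3 = y ⊗ b x. *)
transitivity (phi (b ** x) *: (sigma a ** y)).
  rewrite -mulZ -phi_inv d3M tfold_tfold ?(@lin_tfold _ _ _ _ _ (mul (sigma a))); try linear.
  apply: eq_tfold => m n; rewrite -mulA; congr (_ ** _).
  rewrite (@lin_tfold _ _ _ _ _ (fun z => z ** m)) ?tfold_fuse; try linear.
  by apply: eq_tfold => p q; rewrite Zmul.
have := congr1 (tfold (fun r n => phi n *: (sigma a ** r))) (sigma34 b x y).
rewrite tfold_tn ?tfold_tfold; try linear; move=> <-; apply: eq_tfold => r q.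
rewrite tfold_fuse; last by linear.
under [LHS]eq_tfold do rewrite mulA -sigmaM -Zmul.
rewrite -(@lin_tfold _ _ _ _ _ (fun z => z ** r)); last by linear.
by congr (_ ** _); rewrite (@E34 _ (fun m n => phi n *: sigma m)) //; linear.
Qed.

(* Pairing form of [Δ^(φ(·c))(1 ⊗ φ(·d)) = Σ φ(·q) ⊗ φ(·p)] for [c ⊗ d = Σ Δ(p)(q ⊗ 1)]. *)
Lemma phi_dual_coproduct a b c d u : tfold d3 u = tn c d ->
  phi (a ** tfold (fun p q => phi q *: p) (d1 b d) ** c) =
  tfold (fun p q => (phi (a ** q) : K) * (phi (b ** p) : K) : K^o) u.
Proof.
pose B c d := phi (a ** tfold (fun p q => phi q *: p) (d1 b d) ** c).
have B_bil : bil B by rewrite /B; linear.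
move=> /(congr1 (tfold B)); rewrite tfold_tn // -/(B c d) tfold_tfold // => <-.
apply: eq_tfold => p q.
(* Invariance at the product b p: φ(a b_1 p_1 q) φ(b_2 p_2) = φ(a q) φ(b p). *)
transitivity (phi (a ** tfold (fun p q => phi q *: p) (d3 (b ** p) q))).
  have h_lin : lin (fun z => phi (a ** z)) by linear.
  rewrite d3M tfold_tfold ?(lin_tfold _ _ h_lin); last by linear.
  apply: eq_tfold => m n; rewrite /B -mulA; congr (phi (_ ** _)).
  rewrite (@lin_tfold _ _ _ _ _ (fun z => z ** m)) ?tfold_fuse; try linear.
  by apply: eq_tfold => x y; rewrite (linZ (mul_bil.2 m)).
by rewrite phi_inv (linZ (mul_bil.1 a)) (linZ phi_lin) mulrC.
Qed.

(** * The dual and its action on A *)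

Section Bismash.
Hypothesis sigma_surj : forall z, exists s, sigma s = z.

Variables (D : lmodType K) (ev : D -> A -> K^o) (hat : A -> D) (dsl : D -> A -> A).
Hypothesis ev_bil : bil ev.
Hypothesis ev_inj : forall w, (forall a, ev w a = 0) -> w = 0.
Hypothesis ev_hat : forall c a, ev (hat c) a = phi (a ** c).
Hypothesis hat_surj : forall w, exists c, w = hat c.
Hypothesis dsl2 : forall d w b, d ** dsl w b = tfold (fun p q => ev w q *: p) (d2 d b).
#[local] Hint Resolve ev_bil : bilin.

Lemma mulZr k p d : p ** (k *: d) = k *: (p ** d). Proof. exact: linZ (mul_bil.1 p) k d. Qed.
Lemma mulZl k p d : (k *: p) ** d = k *: (p ** d). Proof. exact: linZ (mul_bil.2 d) k p. Qed.

Lemma mul_tfold (U V U' V' : lmodType K) (B : U -> V -> A) (B' : U' -> V' -> A) t t' :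
  tfold B t ** tfold B' t' = tfold (fun p q => tfold (fun p' q' => B p q ** B' p' q') t') t.
Proof.
rewrite (lin_tfold _ _ (mul_bil.2 _)); apply: eq_tfold => p q.
exact: lin_tfold (mul_bil.1 _).
Qed.

Lemma mulIl (a b : A) : (forall c, a ** c = b ** c) -> a = b.
Proof.
move=> ab; apply/eqP; rewrite -subr_eq0; apply/eqP/ndl => c.
by rewrite (linB (mul_bil.2 c)) ab subrr.
Qed.

Lemma mulIr (a b : A) : (forall c, c ** a = c ** b) -> a = b.
Proof.
move=> ab; apply/eqP; rewrite -subr_eq0; apply/eqP/ndr => c.
by rewrite (linB (mul_bil.1 c)) ab subrr.
Qed.

Lemma dsl_bil : bil dsl.
Proof.
split=> [w|b] k u v; apply: mulIr => d; rewrite (mul_bil.1 d) !dsl2.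
  by have /(_ k u v) -> : lin (fun b => tfold (fun p q => ev w q *: p) (d2 d b)) by linear.
by have /(_ k u v) -> : lin (fun w => tfold (fun p q => ev w q *: p) (d2 d b)) by linear.
Qed.
#[local] Hint Resolve dsl_bil : bilin.

Lemma dsl_hat c b : dsl (hat c) b = tfold (fun p q => phi q *: p) (d1 b c).
Proof.
apply: mulIr => d; rewrite dsl2 (@lin_tfold _ _ _ _ _ (mul d)); last by linear.
under [RHS]eq_tfold do rewrite mulZr.
rewrite (@E12 _ (fun p q => phi q *: p)); last by linear.
by apply: eq_tfold => p q; rewrite ev_hat.
Qed.

Lemma dsl3 w s f : dsl w s ** f = tfold (fun p q => ev w q *: p) (d3 s f).
Proof.
apply: mulIr => d; rewrite mulA dsl2.
rewrite (@lin_tfold _ _ _ _ _ (mul d)) ?(@lin_tfold _ _ _ _ _ (fun z => z ** f)); try linear.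
under [RHS]eq_tfold do rewrite mulZr.
rewrite (@E32 _ (fun p q => ev w q *: p)); last by linear.
by apply: eq_tfold => p q; rewrite mulZl.
Qed.

(** With w = φ(· c) both sides are d a_1 ⊗ a_2 φ(a_3 c). Writing w in this form replaces [dsl w a],
    given only after multiplication, by an explicit sum. *)
Lemma d2_dsl d w a : d2 d (dsl w a) = tfold (fun u v => tn u (dsl w v)) (d2 d a).
Proof.
have [c ->] := hat_surj w; rewrite dsl_hat (@lin_tfold _ _ _ _ _ (d2 d)); last by linear.
under [RHS]eq_tfold do rewrite dsl_hat tn_tfoldr.
under [RHS]eq_tfold do under eq_tfold do rewrite tnZr.
rewrite -(@C12 _ (fun x y r => (phi r : K) *: tn x y)); last by linear.
by apply: eq_tfold => p r; rewrite -scale_tfold tfold_id -(linZ (d2_bil.1 d)).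
Qed.

Lemma d3_dsl w b e : d3 (dsl w b) e = tfold (fun p q => tn p (dsl w q)) (d3 b e).
Proof.
have [c ->] := hat_surj w; rewrite dsl_hat (@lin_tfold _ _ _ _ _ (d3^~ e)); last by linear.
under [RHS]eq_tfold do rewrite dsl_hat tn_tfoldr.
under [RHS]eq_tfold do under eq_tfold do rewrite tnZr.
rewrite (@C31 _ (fun x y r => (phi r : K) *: tn x y)); last by linear.
by apply: eq_tfold => p r; rewrite -scale_tfold tfold_id -(linZ (d3_bil.2 e)).
Qed.

(* [dcop w w'] is the element [Δ^(w)(1 ⊗ w')] of the dual. *)
Variable dcop : D -> D -> ten D D.
Hypothesis dcopP : forall w w' a b,
  tfold (fun k l => (ev k a : K) * (ev l b : K) : K^o) (dcop w w') = ev w (a ** dsl w' b).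

(** Elements of A separate the points of the dual one leg at a time, and K ⊗ K is spanned by 1 ⊗
    1. *)
Lemma dual_ten_eq (t t' : ten D D) :
  (forall a b, tfold (fun k l => (ev k a : K) * (ev l b : K) : K^o) t =
               tfold (fun k l => (ev k a : K) * (ev l b : K) : K^o) t') -> t = t'.
Proof.
move=> tt'; apply: (@cancel1 _ _ _ K^o _ (fun a k => ev k a)) => [a|k|a]; first by linear.
  exact: ev_inj.
apply: (@cancel2 _ _ _ K^o _ (fun b l => ev l b)) => [b|l|b]; first by linear.
  exact: ev_inj.
rewrite !tfold_fuse; try linear.
have E s : tfold (fun k l => tn (ev k a) (ev l b)) s =
    (tfold (fun k l => (ev k a : K) * (ev l b : K) : K^o) s : K) *: tn (1 : K^o) (1 : K^o).
  rewrite (@lin_tfold _ _ _ _ _ (fun c : K^o => (c : K) *: tn (1 : K^o) (1 : K^o))); last first.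
    by apply: lin_scalel; apply: lin_id.
  apply: eq_tfold => k l; rewrite -scalerA -tnZr -tnZl.
  by congr (tn _ _); rewrite [RHS]mulr1.
by rewrite !E tt'.
Qed.

Lemma dcop_bil : bil dcop.
Proof.
have pair_bil a b : bil (fun k l => (ev k a : K) * (ev l b : K) : K^o).
  split=> [k|l] c x y; first by rewrite (ev_bil.2 b) mulrDr mulrCA.
  by rewrite (ev_bil.2 a) mulrDl -mulrA.
split=> [w|w'] k u v; apply: dual_ten_eq => a b; rewrite tfold_lin // !dcopP.
  by rewrite (dsl_bil.2 b) (mul_bil.1 a) (ev_bil.1 w).
by rewrite (ev_bil.2 _).
Qed.

(** A is a module algebra over its dual. Covered by e and f, both sides are the sum of w(v_2 (w' ▷
    s_2)) e v_1 s_1 f, the coefficient being the pairing of Δ^(w)(1 ⊗ w') with v_2 ⊗ s_2. *)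
Lemma dcop_dsl w w' v s :
  tfold (fun k l => dsl k v ** dsl l s) (dcop w w') = dsl w (v ** dsl w' s).
Proof.
apply: mulIl => f; apply: mulIr => e; rewrite !mulA.
rewrite (@lin_tfold _ _ _ _ _ (fun z => e ** z ** f)); last by linear.
transitivity (tfold (fun p q => tfold (fun p' q' =>
    ev w (q ** dsl w' q') *: (p ** p')) (d3 s f)) (d2 e v)).
  under [LHS]eq_tfold do rewrite mulA -mulA dsl2 dsl3 mul_tfold.
  rewrite tfold_exchange; apply: eq_tfold => p q.
  rewrite tfold_exchange; apply: eq_tfold => p' q'.
  rewrite -dcopP (@lin_tfold _ _ _ _ _ (fun c : K^o => (c : K) *: (p ** p'))).
    by apply: eq_tfold => k l; rewrite mulZl mulZr scalerA.
  by apply: lin_scalel; apply: lin_id.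
rewrite dsl2 (@lin_tfold _ _ _ _ _ (fun z => z ** f)); last by linear.
rewrite d2M tfold_tfold; last by linear.
apply: eq_tfold => p q.
under [RHS]eq_tfold do rewrite mulZl.
rewrite tfold_fuse; last by linear.
rewrite -(@E32 _ (fun m n => ev w (q ** n) *: m)); last by linear.
by rewrite d3_dsl tfold_fuse //; linear.
Qed.

(** The module algebra rule [dcop_dsl] under a coproduct: this is how w moves past a factor of the
    smash product when operators are composed. *)
Lemma dcop_d1 w w' a s :
  tfold (fun k l => d1 (dsl k a) (dsl l s)) (dcop w w') =
  tfold (fun p q => tn p (dsl w q)) (d1 a (dsl w' s)).
Proof.
apply: canc_l1 => d; rewrite tfold_fuse; last by linear.
rewrite tfold_tfold; last by linear.
under [LHS]eq_tfold do (rewrite (@E12 _ (@tn _ _ _)); last by linear).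
under [LHS]eq_tfold do (rewrite d2_dsl tfold_fuse; last by linear).
rewrite tfold_exchange (@E12 _ (fun p q => tn p (dsl w q))); last by linear.
by apply: eq_tfold => p q; rewrite -tn_tfoldr dcop_dsl.
Qed.

(** * The map W from R ⊗ A to R # A *)

Variables (R : lmodType K) (mulR : R -> R -> R) (act : A -> R -> R).
Hypothesis mulR_bil : bil mulR.
Hypothesis act_bil : bil act.
Hypothesis mulRA : forall x y z, mulR x (mulR y z) = mulR (mulR x y) z.
Hypothesis ndR : forall x, (forall y, mulR x y = 0) -> x = 0.
Hypothesis act_mul : forall a b x, act (a ** b) x = act a (act b x).
Hypothesis act_unital : forall x, exists s : seq (A * R), x = \sum_(p <- s) act p.1 p.2.
Hypothesis act_alg : forall a b x y, act a (mulR x (act b y)) =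
  tfold (fun p q => mulR (act p x) (act q y)) (d1 a b).
#[local] Hint Resolve mulR_bil act_bil : bilin.

Lemma act_ext (X : lmodType K) (f g : R -> X) : lin f -> lin g ->
  (forall a y, f (act a y) = g (act a y)) -> f =1 g.
Proof.
move=> fl gl fg x; have [s ->] := act_unital x.
by rewrite (lin_sum fl) (lin_sum gl); apply: eq_bigr => p _; apply: fg.
Qed.

(* [W y b] is [b_1 y ⊗ b_2], the product [b y] of the smash product [R # A]. *)
Definition W (y : R) (b : A) : ten R A :=
  \sum_(e <- proj1_sig (cid (act_unital y)))
    tfold (fun p q => tn (act p e.2) q) (d3 b e.1).

(** The right side does not see the decomposition of y chosen in [W]. As left multiplications on the
    second leg separate, this makes [W] independent of the choice, and bilinear. *)
Lemma W_d4 d y b :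
  tfold (fun r q => tn r (d ** q)) (W y b) = tfold (fun p q => tn (act p y) q) (d4 d b).
Proof.
rewrite /W; case: (cid _) => s /= yE.
rewrite (lin_sum (tfold_lin _)); last by linear.
rewrite [in RHS]yE (@lin_sum _ _ _ (fun y => tfold (fun p q => tn (act p y) q) (d4 d b)));
  last by linear.
apply: eq_bigr => e _; rewrite tfold_fuse; last by linear.
rewrite (@E34 _ (fun p q => tn (act p e.2) q)); last by linear.
by apply: eq_tfold => p q; rewrite act_mul.
Qed.

Lemma W_act e y b : W (act e y) b = tfold (fun p q => tn (act p y) q) (d3 b e).
Proof.
apply: canc_l2 => d; rewrite W_d4 tfold_fuse; last by linear.
rewrite (@E34 _ (fun p q => tn (act p y) q)); last by linear.
by apply: eq_tfold => p q; rewrite act_mul.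
Qed.

Lemma W_bil : bil W.
Proof.
have T_lin d : lin (tfold (fun (r : R) q => tn r (d ** q))) by linear.
split=> [y|b] k u v; apply: canc_l2 => d; rewrite T_lin !W_d4.
  by have /(_ k u v) -> : lin (fun b => tfold (fun p q => tn (act p y) q) (d4 d b)) by linear.
by have /(_ k u v) -> : lin (fun y => tfold (fun p q => tn (act p y) q) (d4 d b)) by linear.
Qed.
#[local] Hint Resolve W_bil : bilin.

Lemma W_d1 d y b :
  tfold (fun r q => tn r (q ** d)) (W y b) = tfold (fun p q => tn (act p y) q) (d1 b d).
Proof.
move: y; apply: act_ext => [||a y]; [by linear|by linear|].
rewrite W_act tfold_fuse; last by linear.
rewrite -(@E13 _ (fun p q => tn (act p y) q)); last by linear.
by apply: eq_tfold => p q; rewrite act_mul.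
Qed.

(* A left inverse of [y ⊗ b ↦ W y b], up to the multiplication by [e]. *)
Lemma sigma_W e y b :
  tfold (fun r q => tfold (fun m n => tn (act (sigma m) r) n) (d4 e q)) (W y b) = tn y (e ** b).
Proof.
move: y; apply: act_ext => [||a y]; [by linear|by linear|].
rewrite W_act tfold_fuse; last by linear.
have := congr1 (tfold (fun r n => tn (act r y) n)) (sigma34 e b a).
rewrite tfold_tfold ?tfold_tn; try linear; move=> <-; apply: eq_tfold => p q.
rewrite tfold_fuse; last by linear.
by apply: eq_tfold => m n; rewrite act_mul.
Qed.

Lemma W_inj : injective (tfold W).
Proof.
apply: lin_inj => [|u Wu]; first by linear.
apply: canc_l2 => e.
pose V := tfold (fun r q => tfold (fun m n => tn (act (sigma m) r) n) (d4 e q)).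
have V_lin : lin V by rewrite /V; linear.
have VW : tfold (fun r q => tn r (e ** q)) u = V (tfold W u).
  by rewrite (lin_tfold _ _ V_lin); apply: eq_tfold => r q; rewrite /V sigma_W.
by rewrite VW Wu (lin0 V_lin) (lin0 (tfold_lin _)) //; linear.
Qed.

Lemma W_surj t : exists u, tfold W u = t.
Proof.
have Ws r b : exists u, tfold W u = tn r b.
  have [s ->] := act_unital r; elim: s => [|[a y] s [u us]].
    exists 0; rewrite big_nil (lin0 (tfold_lin _)); last by linear.
    by rewrite (lin0 ((bil_tn _ _).2 b)).
  (* From a ⊗ b = Σ x_1 z ⊗ x_2 follows a y ⊗ b = Σ x_1 z y ⊗ x_2, the image under [W] of Σ z y ⊗
     x. *)
  have [v dv] := T3_surj (tn a b).
  exists (tfold (fun x z => tn (act z y) x) v + u).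
  rewrite big_cons (linD ((bil_tn _ _).2 b)) -us (linD (tfold_lin W_bil)); congr (_ + _).
  rewrite tfold_fuse; last exact: W_bil.
  have := congr1 (tfold (fun a b => tn (act a y) b)) dv.
  rewrite tfold_tfold ?tfold_tn; try linear; move=> <-.
  by apply: eq_tfold => x z; rewrite W_act.
rewrite [t]rep_tn; elim: (rep t) => [|p s [u us]].
  by exists 0; rewrite big_nil (lin0 (tfold_lin _)) //; linear.
have [v vp] := Ws p.1 p.2; exists (v + u).
by rewrite big_cons (linD (tfold_lin W_bil)) us vp.
Qed.

Definition lmulR (x : R) : ten R A -> ten R A := tfold (fun r q => tn (mulR x r) q).

Lemma lmulR_bil : bil lmulR. Proof. by rewrite /lmulR; linear. Qed.
#[local] Hint Resolve lmulR_bil : bilin.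

Lemma act_alg3 q b x y :
  act q (mulR (act b x) y) = tfold (fun p m => mulR (act p x) (act m y)) (d3 q b).
Proof.
move: y; apply: act_ext => [||e y]; [by linear|by linear|].
rewrite act_alg; under [RHS]eq_tfold do rewrite -act_mul.
rewrite -(@E13 _ (fun p m => mulR (act p x) (act m y))); last by linear.
by apply: eq_tfold => p m; rewrite act_mul.
Qed.

(** As [W x a] is the product a x, this is the associativity (a x) y = a (x y): both sides are (a_1
    x)(a_2 y) ⊗ a_3. *)
Lemma lmulR_W x y a :
  tfold (fun r q => lmulR r (W y q)) (W x a) = W (mulR x y) a.
Proof.
move: x; apply: act_ext => [||b x]; [by linear|by linear|].
rewrite W_act tfold_fuse; last by linear.
apply: canc_l2 => d; rewrite W_d4 tfold_tfold; last by linear.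
have lmulRd r t : tfold (fun r q => tn r (d ** q)) (lmulR r t) =
    lmulR r (tfold (fun r q => tn r (d ** q)) t).
  by rewrite /lmulR !tfold_fuse //; linear.
under [LHS]eq_tfold do (rewrite lmulRd W_d4 /lmulR tfold_fuse; last by linear).
rewrite (@C34 _ (fun p m n => tn (mulR (act p x) (act m y)) n)); last by linear.
by apply: eq_tfold => q n; rewrite act_alg3 tn_tfoldl.
Qed.

(* The action of [x # a # w] on [R # A], at [r # q]. *)
Definition smash_act x a w r q : ten R A :=
  tfold (fun p z => tn (mulR x (act p r)) z) (d1 a (dsl w q)).

Lemma smash_act_bil x a w : bil (smash_act x a w).
Proof. by rewrite /smash_act; linear. Qed.
#[local] Hint Resolve smash_act_bil : bilin.

(** Since Δ(w ▷ b) = b_1 ⊗ w ▷ b_2, the functional w sends b y to (w ▷ b) y; then a and x multiply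
    from the left. *)
Lemma smash_act_W x a w y b :
  tfold (smash_act x a w) (W y b) = lmulR x (W y (a ** dsl w b)).
Proof.
move: y; apply: act_ext => [||e y]; [by linear|by linear|].
rewrite !W_act tfold_fuse; last by linear.
rewrite d3M d3_dsl tfold_fuse; last by linear.
rewrite (lin_tfold _ _ (tfold_lin _)) ?(lin_tfold _ _ (lmulR_bil.1 x)); last by linear.
apply: eq_tfold => p q; rewrite tfold_fuse /lmulR ?tfold_fuse; try linear.
by apply: eq_tfold => m n; rewrite act_mul.
Qed.

(** The bismash product acts by composition. Moving w past x' # a' is [dcop_d1]; what remains is the
    associativity of the smash product, whose coproducts [pentagon] regroups. *)
Lemma smash_actM x a w x' a' w' r s :
  tfold (fun k l => tfold (fun y z => smash_act (mulR x (act y x')) z l r s)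
    (d1 a (dsl k a'))) (dcop w w') =
  tfold (smash_act x a w) (smash_act x' a' w' r s).
Proof.
pose G m n := tfold (fun c n' => tn (mulR x (act c (mulR x' (act m r)))) n') (d1 a n).
have G_bil : bil G by rewrite /G; linear.
transitivity (tfold G (tfold (fun k l => d1 (dsl k a') (dsl l s)) (dcop w w'))); last first.
  by rewrite dcop_d1 tfold_fuse // tfold_fuse //; linear.
rewrite tfold_tfold //; apply: eq_tfold => k l.
rewrite (@pentagon _ (fun y m n => tn (mulR (mulR x (act y x')) (act m r)) n)); last by linear.
apply: eq_tfold => m n; apply: eq_tfold => c n'.
rewrite act_alg (lin_tfold _ _ (mulR_bil.1 x)) tn_tfoldl.
by apply: eq_tfold => p q; rewrite mulRA.
Qed.

(** * Faithfulness of the two actions *)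

Definition ev_leg (b : A) : ten (ten R A) D -> ten R A := tfold (fun u w => ev w b *: u).

Lemma ev_leg_lin b : lin (ev_leg b). Proof. by rewrite /ev_leg; linear. Qed.

Lemma ev_leg_inj z : (forall b, ev_leg b z = 0) -> z = 0.
Proof.
move=> z0; apply: (@cancel2 _ _ _ K^o _ (fun b w => ev w b)) => [b|w|b].
- by linear.
- exact: ev_inj.
have E s : tfold (fun u w => tn u (ev w b)) s = tn (ev_leg b s) (1 : K^o).
  rewrite tn_tfoldl; apply: eq_tfold => u w.
  by rewrite tnZl -tnZr; congr (tn _ _); rewrite [RHS]mulr1.
by rewrite !E z0 (lin0 (ev_leg_lin b)).
Qed.

Definition rmulR (y : R) : ten R A -> ten R A := tfold (fun x a => tn (mulR x y) a).

Lemma rmulR_inj u : (forall y, rmulR y u = 0) -> u = 0.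
Proof.
move=> u0; apply: (@cancel1 _ _ _ _ _ (fun y x => mulR x y)) => [y|x|y].
- by linear.
- exact: ndR.
by rewrite [LHS](u0 y) (lin0 (tfold_lin _)) //; linear.
Qed.

(* The operators by which [(R # A) # Â] acts on [R # A], precomposed with [W],
   and those by which [R ⊗ (A ◇ Â)] acts on [R ⊗ A], followed by [W]. *)
Definition bi_act (z : ten (ten R A) D) (r : R) (q : A) : ten R A :=
  tfold (fun u w => tfold (fun x a => smash_act x a w r q) u) z.

Definition bi_op z y b := tfold (bi_act z) (W y b).

Definition dia_op (z : ten (ten R A) D) (y : R) (b : A) : ten R A :=
  tfold (fun u w => ev w b *: tfold (fun x a => W (mulR x y) a) u) z.

Lemma bi_act_bil z : bil (bi_act z).
Proof. by rewrite /bi_act /smash_act; linear. Qed.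
#[local] Hint Resolve bi_act_bil : bilin.

Lemma bi_act_lin r q : lin (fun z => bi_act z r q).
Proof. by rewrite /bi_act /smash_act; linear. Qed.

Lemma bi_op_lin y b : lin (fun z => bi_op z y b).
Proof. by apply: lin_tfold_param => u v; apply: bi_act_lin. Qed.

Lemma dia_op_lin y b : lin (fun z => dia_op z y b).
Proof. by rewrite /dia_op; linear. Qed.

Lemma bi_act_tn x a w r q : bi_act (tn (tn x a) w) r q = smash_act x a w r q.
Proof. by rewrite /bi_act !tfold_tn // /smash_act; linear. Qed.

Lemma bi_op_tn x a w y b :
  bi_op (tn (tn x a) w) y b = lmulR x (W y (a ** dsl w b)).
Proof.
rewrite -smash_act_W; apply: eq_tfold => r q; exact: bi_act_tn.
Qed.

Lemma dia_op_leg z y b : dia_op z y b = tfold W (rmulR y (ev_leg b z)).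
Proof.
rewrite /dia_op /rmulR tfold_fuse; last by linear.
rewrite /ev_leg tfold_tfold; last by linear.
by apply: eq_tfold => u w; rewrite (linZ (tfold_lin _)) //; linear.
Qed.

Lemma dia_op_tn u w y b :
  dia_op (tn u w) y b = ev w b *: tfold (fun x a => W (mulR x y) a) u.
Proof. by rewrite /dia_op tfold_tn //; linear. Qed.

Lemma dia_op_inj z : (forall y b, dia_op z y b = 0) -> z = 0.
Proof.
move=> z0; apply: ev_leg_inj => b; apply: rmulR_inj => y; apply: W_inj.
by rewrite -dia_op_leg z0 (lin0 (tfold_lin _)) //; linear.
Qed.

(** The bridge between the two kinds of operators: once x ⊗ a is written as [tfold W u], the left
    multiplication x · W(y ⊗ a) done after W is W of a multiplication done in R ⊗ A. *)
Lemma lmulR_tfold_W y u :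
  tfold (fun x a => lmulR x (W y a)) (tfold W u) = tfold (fun x a => W (mulR x y) a) u.
Proof.
rewrite tfold_tfold; last by linear.
by apply: eq_tfold => x a; rewrite lmulR_W.
Qed.

Lemma bi_op_inj z : (forall y b, bi_op z y b = 0) -> z = 0.
Proof.
move=> z0.
have zero_bil : bil (fun (_ : R) (_ : A) => 0 : ten R A) by linear.
have act0 r q : bi_act z r q = 0.
  move: r q; apply: (span_eq W_surj (bi_act_bil z) zero_bil) => y b.
  by rewrite -/(bi_op z y b) z0 /tfold big1.
(* This is the sum of w(c) x (a_1 r) ⊗ a_2 d. As (w ▷ q) d = w(q_2) q_1 d, the vanishing operator
   kills it at d ⊗ c = q_1 d' ⊗ q_2, and these span. *)
pose act1 r (d : A) c : ten R A := tfold (fun x a => tfold (fun p n => tn (mulR x (act p r)) n) (d1 a d)) (ev_leg c z).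
have act1_bil r : bil (act1 r) by rewrite /act1 /ev_leg; linear.
have act10 r d c : act1 r d c = 0.
  have zero_bil' : bil (fun (_ : A) (_ : A) => 0 : ten R A) by linear.
  move: d c; apply: (span_eq T3_surj (act1_bil r) zero_bil') => q d.
  transitivity (tfold (fun r q => tn r (q ** d)) (bi_act z r q)); last first.
    by rewrite act0 (lin0 (tfold_lin _)) /tfold ?big1 //; linear.
  rewrite /bi_act /act1 /ev_leg tfold_tfold; last by linear.
  under [LHS]eq_tfold do (rewrite tfold_tfold; last by linear).
  rewrite tfold_exchange; apply: eq_tfold => u w; rewrite tfold_tfold; last by linear.
  under [LHS]eq_tfold do (rewrite (linZ (tfold_lin _)) ?scale_tfold; last by linear).
  rewrite tfold_exchange; apply: eq_tfold => x a.
  transitivity (tfold (fun p n => tn (mulR x (act p r)) n) (d1 a (dsl w q ** d))).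
    rewrite dsl3 (lin_tfold _ _ (d1_bil.1 a)) tfold_tfold; last by linear.
    by apply: eq_tfold => d' c; rewrite (linZ (d1_bil.1 a)) (linZ (tfold_lin _)) //; linear.
  by rewrite d1Mr /smash_act !tfold_fuse //; linear.
(* With the slice of [z] at c written as [tfold W u], the sum of x (a_1 r) ⊗ a_2 becomes W of
   [rmulR r u]; injectivity of W and non-degeneracy of R then give u = 0. *)
apply: ev_leg_inj => c; have [u uz] := W_surj (ev_leg c z).
suff -> : ev_leg c z = 0 by [].
rewrite -uz; suff -> : u = 0 by rewrite (lin0 (tfold_lin W_bil)).
apply: rmulR_inj => r; apply: W_inj; rewrite (lin0 (tfold_lin W_bil)).
have -> : tfold W (rmulR r u) = tfold (fun x a => lmulR x (W r a)) (ev_leg c z).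
  by rewrite -uz lmulR_tfold_W /rmulR tfold_fuse //; linear.
apply: canc_r2 => d.
rewrite (lin0 (tfold_lin _)); last by linear.
rewrite -(act10 r d c) /act1 tfold_tfold; last by linear.
apply: eq_tfold => x a.
transitivity (lmulR x (tfold (fun r q => tn r (q ** d)) (W r a))).
  by rewrite /lmulR !tfold_fuse //; linear.
by rewrite W_d1 /lmulR tfold_fuse //; linear.
Qed.

(** * Matching the operators *)

Lemma dia_of_bi z : exists z', forall y b, bi_op z y b = dia_op z' y b.
Proof.
have add t t' : (exists z', forall y b, bi_op t y b = dia_op z' y b) ->
    (exists z', forall y b, bi_op t' y b = dia_op z' y b) ->
    exists z', forall y b, bi_op (t + t') y b = dia_op z' y b.
  move=> [z1 e1] [z2 e2]; exists (z1 + z2) => y b.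
  by rewrite (linD (bi_op_lin y b)) (linD (dia_op_lin y b)) e1 e2.
have zero : exists z', forall y b, bi_op 0 y b = dia_op z' y b.
  by exists 0 => y b; rewrite (lin0 (bi_op_lin y b)) (lin0 (dia_op_lin y b)).
elim/ten_ind: z => // u w; elim/ten_ind: u => [|t t' Pt Pt'|x a].
- by rewrite (lin0 ((bil_tn _ _).2 w)).
- by rewrite (linD ((bil_tn _ _).2 w)); apply: add.
have [c ->] := hat_surj w; have [a1 <-] := sigma_surj a.
have [Wi [Wi_lin WiK KWi]] := lin_inverse (tfold_lin W_bil) W_inj W_surj.
(* Pulling x ⊗ σ(p) back along W makes each term φ(b q) x · W(y ⊗ σ(p)) an operator of R ⊗ (A ◇
   Â). *)
exists (tfold (fun p q => tn (Wi (tn x (sigma p))) (hat q)) (d3 c a1)) => y b.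
rewrite (lin_tfold _ _ (dia_op_lin y b)) bi_op_tn dsl_hat phi_strong_inv.
rewrite (lin_tfold _ _ (W_bil.1 y)) (lin_tfold _ _ (lmulR_bil.1 x)).
apply: eq_tfold => p q; rewrite dia_op_tn ev_hat -lmulR_tfold_W WiK.
by rewrite tfold_tn ?(linZ (W_bil.1 y)) ?(linZ (lmulR_bil.1 x)) //; linear.
Qed.

Lemma bi_of_dia z : exists z', forall y b, bi_op z' y b = dia_op z y b.
Proof.
have add f g : (exists z', forall y b, bi_op z' y b = f y b) ->
    (exists z', forall y b, bi_op z' y b = g y b) ->
    exists z', forall y b, bi_op z' y b = f y b + g y b.
  by move=> [z1 e1] [z2 e2]; exists (z1 + z2) => y b; rewrite (linD (bi_op_lin y b)) e1 e2.
have zero : exists z', forall y b, bi_op z' y b = 0.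
  by exists 0 => y b; rewrite (lin0 (bi_op_lin y b)).
elim/ten_ind: z => [|z z' Pz Pz'|u w].
- by have [t tP] := zero; exists t => y b; rewrite tP (lin0 (dia_op_lin y b)).
- have [t tP] := add _ _ Pz Pz'; exists t => y b.
  by rewrite tP (linD (dia_op_lin y b)).
have [c ->] := hat_surj w.
(* Not [u] but [tfold W u] is split into pure tensors x ⊗ a, because bismash operators have the form
   x · W(y ⊗ a). *)
suff [t tP] : exists z', forall y b, bi_op z' y b =
    phi (b ** c) *: tfold (fun x a => lmulR x (W y a)) (tfold W u).
  by exists t => y b; rewrite tP dia_op_tn ev_hat lmulR_tfold_W.
elim/ten_ind: (tfold W u) => [|t t' Pt Pt'|x a].
- have [t tP] := zero; exists t => y b.
  by rewrite tP (lin0 (tfold_lin _)) ?scaler0 //; linear.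
- have [z zP] := add _ _ Pt Pt'; exists z => y b.
  by rewrite zP (linD (tfold_lin _)) ?scalerDr //; linear.
have [s <-] := sigma_surj a; have [v vE] := T3_surj (tn s c).
(* As s ⊗ c = Σ Δ(c')(a' ⊗ 1), the terms φ(b q) σ(p) add up to φ(b c) σ(s). *)
exists (tfold (fun c' a' => tn (tn x (sigma a')) (hat c')) v) => y b.
rewrite (lin_tfold _ _ (bi_op_lin y b)) tfold_tn; last by linear.
under eq_tfold do rewrite bi_op_tn dsl_hat phi_strong_inv.
rewrite -(linZ (lmulR_bil.1 x)) -(linZ (W_bil.1 y)).
rewrite -(lin_tfold _ _ (lmulR_bil.1 x)) -(lin_tfold _ _ (W_bil.1 y)); congr (lmulR _ (W _ _)).
have := congr1 (tfold (fun p q => phi (b ** q) *: sigma p)) vE.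
by rewrite tfold_tfold ?tfold_tn //; linear.
Qed.

(** * The products and the isomorphism *)

Definition bi_pure x a w x' a' w' : ten (ten R A) D :=
  tfold (fun k l => tfold (fun y n => tn (tn (mulR x (act y x')) n) l) (d1 a (dsl k a')))
    (dcop w w').

Definition bi_mulr x a w (z' : ten (ten R A) D) : ten (ten R A) D :=
  tfold (fun u' w' => tfold (fun x' a' => bi_pure x a w x' a' w') u') z'.

Definition bi_mul (z z' : ten (ten R A) D) : ten (ten R A) D :=
  tfold (fun u w => tfold (fun x a => bi_mulr x a w z') u) z.

Lemma bi_pure_bil1 x l x' : bil (fun y n => tn (tn (mulR x (act y x')) n) l : ten (ten R A) D).
Proof. by linear. Qed.

Lemma bi_pure_bil x a x' a' :
  bil (fun k l => tfold (fun y n => tn (tn (mulR x (act y x')) n) l) (d1 a (dsl k a'))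
       : ten (ten R A) D).
Proof. by linear. Qed.

Lemma bi_pure_tril x a w : tril (bi_pure x a w).
Proof. by have db := dcop_bil; rewrite /bi_pure; linear. Qed.

Lemma bi_mulr_tril z' : tril (fun x a w => bi_mulr x a w z').
Proof. by have db := dcop_bil; rewrite /bi_mulr /bi_pure; linear. Qed.

Definition dia_mul (z z' : ten (ten R A) D) : ten (ten R A) D :=
  tfold (fun u w => tfold (fun x a => tfold (fun u' w' => tfold (fun x' a' =>
    tn (tn (mulR x x') (ev w a' *: a)) w') u') z') u) z.

Lemma bi_act_mul z z' r s : bi_act (bi_mul z z') r s = tfold (bi_act z) (bi_act z' r s).
Proof.
have bl := bi_act_lin r s.
transitivity (tfold (fun u w => tfold (fun x a =>
    tfold (smash_act x a w) (bi_act z' r s)) u) z); last first.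
  transitivity (tfold (fun r q => tfold (fun u w =>
      tfold (fun x a => smash_act x a w r q) u) z) (bi_act z' r s)) => //.
  by rewrite tfold_exchange; apply: eq_tfold => u w; rewrite tfold_exchange.
rewrite (lin_tfold _ _ bl); apply: eq_tfold => u w.
rewrite (lin_tfold _ _ bl); apply: eq_tfold => x a.
rewrite /bi_mulr (lin_tfold _ _ bl) [in RHS]/bi_act tfold_tfold; last by linear.
apply: eq_tfold => u' w'.
rewrite (lin_tfold _ _ bl) tfold_tfold; last by linear.
apply: eq_tfold => x' a'.
rewrite /bi_pure (lin_tfold _ _ bl) -smash_actM; apply: eq_tfold => k l.
by rewrite (lin_tfold _ _ bl); apply: eq_tfold => y n; rewrite bi_act_tn.
Qed.

Lemma dia_op_mul z z' y b :
  dia_op (dia_mul z z') y b =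
  tfold (fun u w => ev w b *: tfold (fun x a => dia_op z (mulR x y) a) u) z'.
Proof.
have dl := dia_op_lin y b.
rewrite (lin_tfold _ _ dl).
under [LHS]eq_tfold do rewrite (lin_tfold _ _ dl).
under [LHS]eq_tfold do under eq_tfold do rewrite (lin_tfold _ _ dl).
under [LHS]eq_tfold do rewrite tfold_exchange.
rewrite tfold_exchange; apply: eq_tfold => u' w'.
under [LHS]eq_tfold do under eq_tfold do rewrite (lin_tfold _ _ dl).
under [LHS]eq_tfold do rewrite tfold_exchange.
rewrite tfold_exchange scale_tfold; apply: eq_tfold => x' a'.
rewrite /dia_op scale_tfold; apply: eq_tfold => u w; rewrite !scale_tfold.
apply: eq_tfold => x a; rewrite -/(dia_op _ _ _) dia_op_tn tfold_tn; last by linear.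
by rewrite (linZ (W_bil.1 _)) mulRA.
Qed.

Lemma bismash_iso : exists F : ten (ten R A) D -> ten (ten R A) D,
  [/\ lin F, bijective F & forall z z', F (bi_mul z z') = dia_mul (F z) (F z')].
Proof.
pose F z := proj1_sig (cid (dia_of_bi z)).
have FP z y b : bi_op z y b = dia_op (F z) y b := proj2_sig (cid (dia_of_bi z)) y b.
have F_uniq z z' : (forall y b, bi_op z y b = dia_op z' y b) -> F z = z'.
  move=> zz'; apply/eqP; rewrite -subr_eq0; apply/eqP/dia_op_inj => y b.
  by rewrite (linB (dia_op_lin y b)) -FP zz' subrr.
have F_lin : lin F.
  by move=> k z z'; apply: F_uniq => y b; rewrite bi_op_lin dia_op_lin !FP.
exists F; split=> // [|z z'].
  pose G z := proj1_sig (cid (bi_of_dia z)).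
  have GP z y b : bi_op (G z) y b = dia_op z y b := proj2_sig (cid (bi_of_dia z)) y b.
  exists G => z; last exact: F_uniq.
  apply/eqP; rewrite -subr_eq0; apply/eqP/bi_op_inj => y b.
  by rewrite (linB (bi_op_lin y b)) GP FP subrr.
(* The operators run from R ⊗ A to R # A, so the outer factor acts after W on one side and before W
   on the other; [FP] is used once for each factor. *)
apply: F_uniq => y b; rewrite dia_op_mul.
transitivity (tfold (bi_act z) (bi_op z' y b)).
  rewrite /bi_op [RHS]tfold_tfold; last exact: bi_act_bil.
  by apply: eq_tfold => r s; apply: bi_act_mul.
have zl := tfold_lin (bi_act_bil z).
rewrite FP /dia_op (lin_tfold _ _ zl); apply: eq_tfold => u w.
rewrite (linZ zl) (lin_tfold _ _ zl); congr (_ *: _).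
by apply: eq_tfold => x a; rewrite -/(bi_op z _ _) FP.
Qed.

End Bismash.

End Antipode.

End CoveredCoproduct.

(** * Transport to the tensors of the statement *)

Section Tensor2.
Variables U V : lmodType CC.

Definition tsums (s : seq (U * V)) : ten U V := \sum_(p <- s) tn p.1 p.2.

Lemma tsums_form s : val (tsums s) = tform s.
Proof.
apply/funext => f; apply/funext => g; rewrite lin_tn /tsums (lin_sum (tfold_lin _)).
  rewrite linear_sum; apply: eq_bigr => p _.
  rewrite tfold_tn; first by rewrite linearZ /= mulrC.
  by split=> [u|v]; [apply/lin_scalel/scalar_lin|apply/lin_scale/lin_id].
by split=> [u|v]; [apply/lin_scalel/scalar_lin|apply/lin_scale/lin_id].
Qed.

Lemma tfold_tsums (X : lmodType CC) (B : U -> V -> X) s : bil B ->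
  tfold B (tsums s) = \sum_(p <- s) B p.1 p.2.
Proof.
move=> Bb; rewrite (lin_sum (tfold_lin Bb)); apply: eq_bigr => p _; exact: tfold_tn.
Qed.

Definition toT (t : tensor U V) : ten U V := tsums (trep t).

Lemma trep_tev (t : tensor U V) : tev (trep t) = sval t.
Proof. by rewrite -(proj2_sig (cid (proj2_sig t))). Qed.

Lemma tsums_tev s s' : tev s = tev s' -> tsums s = tsums s'.
Proof. by move=> ss'; apply/val_inj; rewrite /= !tsums_form; exact: ss'. Qed.

Lemma toT_of s : toT (tensor_of s) = tsums s.
Proof. by apply: tsums_tev; rewrite trep_tev. Qed.

Lemma toT_inj : injective toT.
Proof.
move=> t t' /(congr1 val); rewrite !tsums_form => tt'.
have {tt'} : sval t = sval t' by rewrite -!trep_tev; exact: tt'.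
by move: t t' => [t tP] [t' tP'] /= tt'; apply: eq_exist.
Qed.

Lemma tlift_toT (X : lmodType CC) (B : U -> V -> X) t : bil B ->
  tlift B t = tfold B (toT t).
Proof. by move=> Bb; rewrite tfold_tsums. Qed.

Lemma toT_rep (t : ten U V) : toT (tensor_of (rep t)) = t.
Proof. by rewrite toT_of [RHS]rep_tn. Qed.

Lemma toT_add t t' : toT (tadd t t') = toT t + toT t'.
Proof. by rewrite toT_of /tsums big_cat. Qed.

Lemma toT_scale k t : toT (tscale k t) = k *: toT t.
Proof.
rewrite toT_of /tsums big_map scaler_sumr; apply: eq_bigr => p _; exact: tnZl.
Qed.

Lemma toT_map f g t : lin f -> lin g ->
  toT (tmap f g t) = tfold (fun p q => tn (f p) (g q)) (toT t).
Proof. by move=> fl gl; rewrite toT_of /tsums big_map tfold_tsums //; linear. Qed.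

Lemma toT_sum (ts : seq (tensor U V)) : toT (tsum ts) = \sum_(t <- ts) toT t.
Proof.
rewrite toT_of /tsums; elim: ts => [|t ts IH]; first by rewrite !big_nil.
by rewrite big_cons -IH /= big_cat.
Qed.

End Tensor2.

Lemma toT_flip (U V : lmodType CC) (t : tensor U V) : toT (tflip t) = flip (toT t).
Proof.
rewrite toT_of /tsums big_map /flip tfold_tsums //; exact: bil_flip.
Qed.

Section Tensor3.
Variables U V W : lmodType CC.

Definition tsums3 (s : seq (U * V * W)) : ten (ten U V) W :=
  \sum_(p <- s) tn (tn p.1.1 p.1.2) p.2.

Definition toT3 (t : tensor3 U V W) := tsums3 (trep3 t).

Lemma trep3_tev (t : tensor3 U V W) : tev3 (trep3 t) = sval t.
Proof. by rewrite -(proj2_sig (cid (proj2_sig t))). Qed.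

Lemma mul_bil_scalar (f : {scalar U}) (g : {scalar V}) :
  bil (fun u v => (f u : CC) * (g v : CC) : CC^o).
Proof.
split=> [u|v] k x y; first by rewrite linearP mulrDr mulrCA.
by rewrite linearP mulrDl -mulrA.
Qed.

(** Forwards, slicing the last leg by a functional reduces to two legs; backwards, the form is a
    [tfold] of the tensor. *)
Lemma tsums3_tev s s' : tev3 s = tev3 s' <-> tsums3 s = tsums3 s'.
Proof.
split=> [ss'|].
  have sb (h : {scalar W}) : bil (fun (u : ten U V) w => (h w : CC) *: u).
    by split=> [u|v]; [apply/lin_scalel/scalar_lin|apply/lin_scale/lin_id].
  have E (h : {scalar W}) r : tfold (fun (u : ten U V) w => (h w : CC) *: u) (tsums3 r) =
      tsums [seq (h p.2 *: p.1.1, p.1.2) | p <- r].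
    rewrite /tsums3 (lin_sum (tfold_lin (sb h))) /tsums big_map.
    by apply: eq_bigr => p _; rewrite tfold_tn // tnZl.
  apply: ten_sep_l => h; rewrite !E; apply: tsums_tev.
  apply/funext => f; apply/funext => g; rewrite /tev !big_map /=.
  have F r : \sum_(p <- r) f (h p.2 *: p.1.1) * g p.1.2 = tev3 r f g h.
    by apply: eq_bigr => p _; rewrite linearZ /= -mulrA mulrC.
  by rewrite !F ss'.
move=> ss'; apply/funext => f; apply/funext => g; apply/funext => h.
pose T (u : ten U V) (w : W) : CC^o :=
  (tfold (fun u v => (f u : CC) * (g v : CC) : CC^o) u : CC) * (h w : CC).
have fgl := tfold_lin (mul_bil_scalar f g).
have Tb : bil T.
  split=> [u|w] k x y; first by rewrite /T linearP mulrDr mulrCA.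
  apply: (@lin_comp _ _ _ _ (fun c : CC^o => (c : CC) * (h w : CC) : CC^o)) fgl _ _ _.
  by move=> l c d; rewrite [LHS]mulrDl -[in LHS]mulrA.
have E r : tev3 r f g h = tfold T (tsums3 r).
  rewrite /tsums3 (lin_sum (tfold_lin Tb)); apply: eq_bigr => p _.
  by rewrite tfold_tn // /T tfold_tn //; apply: mul_bil_scalar.
by rewrite !E ss'.
Qed.

Lemma toT3_of s : toT3 (tensor3_of s) = tsums3 s.
Proof. by apply/tsums3_tev; rewrite trep3_tev. Qed.

Lemma toT3_inj : injective toT3.
Proof.
move=> t t' /tsums3_tev; rewrite !trep3_tev.
by move: t t' => [t tP] [t' tP'] /= tt'; apply: eq_exist.
Qed.

Lemma toT3_surj z : exists t, toT3 t = z.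
Proof.
suff [s <-] : exists s, tsums3 s = z by exists (tensor3_of s); rewrite toT3_of.
have add t t' : (exists s, tsums3 s = t) -> (exists s, tsums3 s = t') ->
    exists s, tsums3 s = t + t'.
  by move=> [s <-] [s' <-]; exists (s ++ s'); rewrite /tsums3 big_cat.
have zero : exists s, tsums3 s = 0 by exists [::]; rewrite /tsums3 big_nil.
elim/ten_ind: z => // u w; elim/ten_ind: u => [|t t' Pt Pt'|x a].
- by rewrite (lin0 ((bil_tn _ _).2 w)).
- by rewrite (linD ((bil_tn _ _).2 w)); apply: add.
by exists [:: (x, a, w)]; rewrite /tsums3 big_seq1.
Qed.

Lemma toT3_add t t' : toT3 (tadd3 t t') = toT3 t + toT3 t'.
Proof. by rewrite toT3_of /tsums3 big_cat. Qed.

Lemma toT3_scale k t : toT3 (tscale3 k t) = k *: toT3 t.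
Proof.
rewrite toT3_of /tsums3 big_map scaler_sumr; apply: eq_bigr => p _ /=.
by rewrite !tnZl.
Qed.

End Tensor3.

Lemma tfold_tsums3 (U V W X : lmodType CC) (G : U -> V -> W -> X) s : tril G ->
  tfold (fun u w => tfold (fun x a => G x a w) u) (tsums3 s) =
  \sum_(p <- s) G p.1.1 p.1.2 p.2.
Proof.
move=> Gt; rewrite /tsums3 (lin_sum (tfold_lin (bil_tfold12 Gt))).
apply: eq_bigr => p _.
by rewrite !tfold_tn //; [apply: tril12|apply: bil_tfold12].
Qed.

Lemma bilinear_bil (U V X : lmodType CC) (B : {bilinear U -> V -> X}) : bil B.
Proof. by split=> [u|v] k x y; [apply: linearPr|apply: linearPl]. Qed.

Lemma bij_toT (U V U' V' : lmodType CC) (f : tensor U V -> tensor U' V')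
    (d : ten U V -> ten U' V') :
  (forall t, toT (f t) = d (toT t)) -> bijective f ->
  injective d /\ forall t, exists u, d u = t.
Proof.
move=> fd [g fK gK]; split=> [u u'|t].
  by rewrite -(toT_rep u) -(toT_rep u') -!fd => /toT_inj /(can_inj fK) ->.
by exists (toT (g (tensor_of (rep t)))); rewrite -fd gK toT_rep.
Qed.

(** * The axioms as relations between covered coproducts *)

Section Quantum.
Variables (A : lmodType CC) (mul : {bilinear A -> A -> A}).
Variables (Delta : A -> multiplier (tmul mul)) (phi : {scalar A}).
Hypothesis HA : is_AQG Delta phi.
Let mb : bil mul := bilinear_bil mul.
#[local] Hint Resolve mb : bilin.

Let d1 a b := toT (D1 Delta a b).
Let d2 a b := toT (D2 Delta a b).
Let d3 a b := toT (D3 Delta a b).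
Let d4 a b := toT (D4 Delta a b).

(** Membership excludes the default value of [as_tensor]; the covered element is then handled
    through the products x u. *)
Lemma as_tensorP (l r : tensor A A -> tensor A A) x :
  in_tensor mul l r -> r x = tmul mul x (as_tensor mul l r).
Proof.
by rewrite /as_tensor => h; case: pselect => // h'; case: (cid h') => u [].
Qed.

Lemma toT_mul (t u : tensor A A) : toT (tmul mul t u) =
  tfold (fun p q => tfold (fun m n => tn (mul p m) (mul q n)) (toT u)) (toT t).
Proof.
rewrite toT_of /tsums big_allpairs_dep tfold_tsums; last by linear.
by apply: eq_bigr => p _; rewrite tfold_tsums //; linear.
Qed.

Lemma toT_pure (u v : A) : toT (tensor_of [:: (u, v)]) = tn u v.
Proof. by rewrite toT_of /tsums big_seq1. Qed.

Lemma toT_mul_pure u v (t : tensor A A) : toT (tmul mul (tensor_of [:: (u, v)]) t) =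
  tfold (fun m n => tn (mul u m) (mul v n)) (toT t).
Proof. by rewrite toT_mul toT_pure tfold_tn //; linear. Qed.

Lemma pure_mul u v t : tfold (fun p q => tn (mul u p) (mul v q)) (toT t) =
  toT (tmul mul (tensor_of [:: (u, v)]) t).
Proof. by rewrite toT_mul_pure. Qed.

Lemma tmul_D1 a b x : toT (tmul mul x (D1 Delta a b)) =
  tfold (fun p q => tn p (mul q b)) (toT (DR Delta a x)).
Proof. by rewrite -(as_tensorP _ (Defs.cover1 HA a b)) toT_map //; linear. Qed.

Lemma tmul_D2 a b x :
  tmul mul x (D2 Delta a b) = DR Delta b (tmap (mul^~ a) id x).
Proof. by rewrite -(as_tensorP _ (Defs.cover2 HA a b)). Qed.

Lemma tmul_D3 a b x : toT (tmul mul x (D3 Delta a b)) =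
  tfold (fun p q => tn (mul p b) q) (toT (DR Delta a x)).
Proof. by rewrite -(as_tensorP _ (Defs.cover3 HA a b)) toT_map //; linear. Qed.

Lemma tmul_D4 a b x :
  tmul mul x (D4 Delta a b) = DR Delta b (tmap id (mul^~ a) x).
Proof. by rewrite -(as_tensorP _ (Defs.cover4 HA a b)). Qed.

(** Non-degeneracy of A ⊗ A, one leg at a time: relations can be checked after multiplication by u ⊗
    v, where [DR] computes (u ⊗ v)Δ(a). *)
Lemma canc_pure (t t' : ten A A) :
  (forall u v, tfold (fun p q => tn (mul u p) (mul v q)) t =
               tfold (fun p q => tn (mul u p) (mul v q)) t') -> t = t'.
Proof.
move=> tt'; apply: (canc_l1 mb (mul_nondeg_r HA)) => u.
apply: (canc_l2 mb (mul_nondeg_r HA)) => v.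
by rewrite !tfold_fuse //; linear.
Qed.

Lemma tmap_pure (f g : A -> A) u v : lin f -> lin g ->
  tmap f g (tensor_of [:: (u, v)]) = tensor_of [:: (f u, g v)].
Proof.
move=> fl gl; apply: toT_inj; rewrite toT_map // !toT_pure tfold_tn //; linear.
Qed.

Lemma toT_DR k a b x : toT (DR Delta (k *: a + b) x) =
  k *: toT (DR Delta a x) + toT (DR Delta b x).
Proof. by rewrite (Delta_linear_r HA) toT_add toT_scale. Qed.

Lemma d1_bil : bil d1.
Proof.
have Tl : lin (tfold (fun (q : A) (p : A) => tn q p)) by linear.
split=> [a|b] k x y; apply: canc_pure => u v;
  have Pl : lin (tfold (fun p q : A => tn (mul u p) (mul v q))) by linear.
  rewrite Pl !pure_mul !tmul_D1.
  set t := toT _; move: t => t.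
  by have /(_ k x y) -> : lin (fun x => tfold (fun p q => tn p (mul q x)) t) by linear.
rewrite Pl !pure_mul !tmul_D1 toT_DR.
by have -> : lin (tfold (fun p q : A => tn p (mul q b))) by linear.
Qed.

Lemma d3_bil : bil d3.
Proof.
split=> [a|b] k x y; apply: canc_pure => u v;
  have Pl : lin (tfold (fun p q : A => tn (mul u p) (mul v q))) by linear.
  rewrite Pl !pure_mul !tmul_D3.
  set t := toT _; move: t => t.
  by have /(_ k x y) -> : lin (fun x => tfold (fun p q => tn (mul p x) q) t) by linear.
rewrite Pl !pure_mul !tmul_D3 toT_DR.
by have -> : lin (tfold (fun p q : A => tn (mul p b) q)) by linear.
Qed.
#[local] Hint Resolve d1_bil d3_bil : bilin.

(** After multiplication by u ⊗ v both sides are (u c ⊗ v)Δ(a)(1 ⊗ b). *)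
Lemma d12 a b c : tfold (fun p q => tn (mul c p) q) (d1 a b) =
  tfold (fun p q => tn p (mul q b)) (d2 c a).
Proof.
apply: canc_pure => u v; rewrite !tfold_fuse; try linear.
under eq_tfold do rewrite (mul_assoc HA).
rewrite pure_mul tmul_D1; under [RHS]eq_tfold do rewrite (mul_assoc HA).
rewrite -(@tfold_fuse _ _ _ _ _ _ (fun p q => tn p (mul q b))
  (fun p q => mul u p) (fun p q => mul v q)); last by linear.
by rewrite pure_mul tmul_D2 tmap_pure //; linear.
Qed.

Lemma d32 a b c : tfold (fun p q => tn (mul c p) q) (d3 a b) =
  tfold (fun p q => tn (mul p b) q) (d2 c a).
Proof.
apply: canc_pure => u v; rewrite !tfold_fuse; try linear.
under eq_tfold do rewrite (mul_assoc HA).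
rewrite pure_mul tmul_D3; under [RHS]eq_tfold do rewrite (mul_assoc HA).
rewrite -(@tfold_fuse _ _ _ _ _ _ (fun p q => tn (mul p b) q)
  (fun p q => mul u p) (fun p q => mul v q)); last by linear.
by rewrite pure_mul tmul_D2 tmap_pure //; linear.
Qed.

Lemma d14 a b c : tfold (fun p q => tn p (mul c q)) (d1 a b) =
  tfold (fun p q => tn p (mul q b)) (d4 c a).
Proof.
apply: canc_pure => u v; rewrite !tfold_fuse; try linear.
under eq_tfold do rewrite (mul_assoc HA).
rewrite pure_mul tmul_D1; under [RHS]eq_tfold do rewrite (mul_assoc HA).
rewrite -(@tfold_fuse _ _ _ _ _ _ (fun p q => tn p (mul q b))
  (fun p q => mul u p) (fun p q => mul v q)); last by linear.
by rewrite pure_mul tmul_D4 tmap_pure //; linear.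
Qed.

Lemma d34 a b c : tfold (fun p q => tn p (mul c q)) (d3 a b) =
  tfold (fun p q => tn (mul p b) q) (d4 c a).
Proof.
apply: canc_pure => u v; rewrite !tfold_fuse; try linear.
under eq_tfold do rewrite (mul_assoc HA).
rewrite pure_mul tmul_D3; under [RHS]eq_tfold do rewrite (mul_assoc HA).
rewrite -(@tfold_fuse _ _ _ _ _ _ (fun p q => tn (mul p b) q)
  (fun p q => mul u p) (fun p q => mul v q)); last by linear.
by rewrite pure_mul tmul_D4 tmap_pure //; linear.
Qed.

Lemma d2_bil : bil d2.
Proof.
split=> [c|a] k x y; apply: (canc_r2 mb (mul_nondeg_l HA)) => b;
  have Pl : lin (tfold (fun (p q : A) => tn p (mul q b))) by linear.
  rewrite Pl -!d12.
  by have /(_ k x y) -> : lin (fun x => tfold (fun p q => tn (mul c p) q) (d1 x b)) by linear.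
rewrite Pl -!d12.
by have /(_ k x y) -> : lin (fun x => tfold (fun p q => tn (mul x p) q) (d1 a b)) by linear.
Qed.

Lemma d4_bil : bil d4.
Proof.
split=> [c|a] k x y; apply: (canc_r2 mb (mul_nondeg_l HA)) => b;
  have Pl : lin (tfold (fun (p q : A) => tn p (mul q b))) by linear.
  rewrite Pl -!d14.
  by have /(_ k x y) -> : lin (fun x => tfold (fun p q => tn p (mul c q)) (d1 x b)) by linear.
rewrite Pl -!d14.
by have /(_ k x y) -> : lin (fun x => tfold (fun p q => tn p (mul x q)) (d1 a b)) by linear.
Qed.
#[local] Hint Resolve d2_bil d4_bil : bilin.

Lemma d1M a b c : d1 (mul a b) c =
  tfold (fun m n => tfold (fun p q => tn (mul p m) q) (d1 a n)) (d1 b c).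
Proof.
apply: canc_pure => u v; rewrite pure_mul tmul_D1 (Delta_mul_r HA) -tmul_D1 toT_mul.
rewrite tfold_exchange tfold_tfold; last by linear.
apply: eq_tfold => m n; rewrite tfold_fuse; last by linear.
under [RHS]eq_tfold do rewrite (mul_assoc HA).
rewrite -(@tfold_fuse _ _ _ _ _ _ (fun p q => tn (mul p m) q)
  (fun p q => mul u p) (fun p q => mul v q)); last by linear.
by rewrite pure_mul tmul_D1 tfold_fuse //; linear.
Qed.

Lemma coassoc12 a b c :
  tfold (fun p r => tfold (fun x y => tn (tn x y) r) (d2 a p)) (d1 b c) =
  tfold (fun p q => tfold (fun y z => tn (tn p y) z) (d1 q c)) (d2 a b).
Proof.
have := congr1 (@toT3 _ _ _) (coassoc HA a b c).
rewrite !toT3_of /tsums3 /= !big_allpairs_dep /=.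
rewrite !tfold_tsums; try linear.
under [X in X = _ -> _]eq_bigr do
  (rewrite -(@tfold_tsums _ _ _ (fun x y => tn (tn x y) _)); last by linear).
under [X in _ = X -> _]eq_bigr do
  (rewrite -(@tfold_tsums _ _ _ (fun x y => tn (tn _ x) y)); last by linear).
by [].
Qed.

Lemma toT_T1 t : toT (T1 Delta t) = tfold d1 (toT t).
Proof. by rewrite toT_sum big_map tfold_tsums //; linear. Qed.

Lemma toT_T2 t : toT (T2 Delta t) = tfold d2 (toT t).
Proof. by rewrite toT_sum big_map tfold_tsums //; linear. Qed.

Lemma toT_T1op t : toT (T1op Delta t) = flip (tfold d3 (toT t)).
Proof.
rewrite toT_sum big_map tfold_tsums ?(lin_sum (@flip_lin _ _ _)); last by linear.
by apply: eq_bigr => p _; rewrite toT_flip.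
Qed.

Lemma d1_bij : injective (tfold d1) /\ forall t, exists u, tfold d1 u = t.
Proof. exact: bij_toT toT_T1 (T1_bij HA). Qed.

Lemma d2_surj t : exists u, tfold d2 u = t.
Proof. exact: (bij_toT toT_T2 (T2_bij HA)).2. Qed.

Lemma d3_bij : injective (tfold d3) /\ forall t, exists u, tfold d3 u = t.
Proof.
have [finj fsurj] := @bij_toT _ _ _ _ _ (fun t => flip (tfold d3 t)) toT_T1op (T1op_bij HA).
split=> [u u' uu'|t]; first by apply: finj; rewrite uu'.
by have [u uE] := fsurj (flip t); exists u; rewrite -[LHS]flipK uE flipK.
Qed.

Let phil : A -> CC^o := phi.

Lemma phi_lin : lin phil. Proof. exact: scalar_lin. Qed.
#[local] Hint Resolve phi_lin : bilin.

Lemma slice_rightE t : slice_right phi t = tfold (fun p q => phil q *: p) (toT t).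
Proof. by rewrite /slice_right tlift_toT //; linear. Qed.

Lemma phi_inv a b : tfold (fun p q => phil q *: p) (d3 a b) = phil a *: b.
Proof. by rewrite -(phi_left_inv HA) slice_rightE. Qed.

(** * The dual through its pairing with A *)

Notation D := (dualA mul phi).

Definition ev (w : D) (a : A) : CC^o := dapp w a.

Fact hat_subproof c : (fun a => phi (mul a c) : CC^o) \in dual_pred mul phi.
Proof. by apply/asboolP; exists c. Qed.

Definition hat c : D :=
  exist (fun w : A -> CC^o => w \in dual_pred mul phi) _ (hat_subproof c).

Lemma ev_hat c a : ev (hat c) a = phil (mul a c).
Proof. by []. Qed.

Lemma ev_dcoef w a : ev w a = phi (mul a (dcoef w)).
Proof.
by rewrite /dcoef; case: (cid _) => c /= wc; apply: (congr1 (fun h => h a) wc).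
Qed.

Lemma dval_lin k (w w' : D) : val (k *: w + w') = k *: val w + val w'.
Proof. reflexivity. Qed.

Lemma ev_bil : bil ev.
Proof.
split=> [w|a] k x y; last by rewrite /ev /dapp dval_lin.
rewrite !ev_dcoef.
by have /(_ k x y) : lin (fun z => phil (mul z (dcoef w))) by linear.
Qed.

Lemma ev_eq (w w' : D) : (forall a, ev w a = ev w' a) -> w = w'.
Proof. by move=> ww'; apply/val_inj/funext => a; apply: ww'. Qed.

Lemma ev0 (w : D) : (forall a, ev w a = 0) -> w = 0.
Proof.
move=> w0; apply: ev_eq => a; rewrite w0.
by rewrite (lin0 (ev_bil.2 a)).
Qed.

Lemma hat_surj (w : D) : exists c, w = hat c.
Proof. by exists (dcoef w); apply: ev_eq => a; rewrite ev_dcoef. Qed.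

Lemma dsliceE (w : D) b : dslice Delta w b = tfold (fun p q => phil q *: p) (d1 b (dcoef w)).
Proof. exact: slice_rightE. Qed.

Lemma dslice_d2 d (w : D) b :
  mul d (dslice Delta w b) = tfold (fun p q => ev w q *: p) (d2 d b).
Proof.
rewrite dsliceE (@lin_tfold _ _ _ _ _ (mul d)); last by linear.
under eq_tfold do rewrite (linZ (mb.1 d)).
rewrite (@E12 _ _ _ _ _ d12 _ (fun p q => phil q *: p)); last by linear.
by apply: eq_tfold => p q; rewrite ev_dcoef.
Qed.

(** The default value of [dcop] is excluded by exhibiting Δ^(w)(1 ⊗ w'): for w = φ(· c) and w' = φ(·
    d), write c ⊗ d as Σ Δ(p)(q ⊗ 1) and take Σ φ(· q) ⊗ φ(· p). *)
Lemma dcopP (w w' : D) a b :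
  tfold (fun k l => (ev k a : CC) * (ev l b : CC) : CC^o) (toT (dcop Delta w w')) =
  ev w (mul a (dslice Delta w' b)).
Proof.
have pair_bil x y : bil (fun k l => (ev k x : CC) * (ev l y : CC) : CC^o).
  split=> [k|l] c v v'; first by rewrite (ev_bil.2 y) mulrDr mulrCA.
  by rewrite (ev_bil.2 x) mulrDl -mulrA.
have [u uE] := d3_bij.2 (tn (dcoef w) (dcoef w')).
have ex : exists T, dcop_prop Delta w w' T.
  exists (tensor_of [seq (hat i.2, hat i.1) | i <- rep u]) => x y.
  have := @tlift_toT _ _ CC^o _ (tensor_of [seq (hat i.2, hat i.1) | i <- rep u]) (pair_bil x y).
  rewrite toT_of (tfold_tsums _ (pair_bil x y)) big_map => tE.
  apply: (etrans tE); rewrite -[RHS]/(ev _ _) ev_dcoef dsliceE.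
  exact: esym (phi_dual_coproduct mb (mul_assoc HA) (mul_nondeg_l HA)
    (mul_nondeg_r HA) d1_bil d12 d32 d1M phi_lin phi_inv _ _ uE).
rewrite -(tlift_toT _ (pair_bil a b)) /dcop.
by case: pselect => // ex'; apply: (proj2_sig (cid ex')).
Qed.

(** * Transport of the products and conclusion *)

Variables (R : lmodType CC) (mulR : {bilinear R -> R -> R}) (act : {bilinear A -> R -> R}).
Hypothesis HR : is_module_algebra Delta mulR act.

Lemma act_d1 a b x y : act a (mulR x (act b y)) =
  tfold (fun p q => mulR (act p x) (act q y)) (d1 a b).
Proof.
have mRb := bilinear_bil mulR; have ab := bilinear_bil act.
by rewrite (act_module_algebra HR) tfold_tsums //; linear.
Qed.

Lemma toT3_dia t t' : toT3 (@diamond_mul A mul phi R mulR t t') = dia_mul ev mulR (toT3 t) (toT3 t').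
Proof.
have eb := ev_bil; have mRb := bilinear_bil mulR.
rewrite toT3_of /dia_mul (@tfold_tsums3 _ _ _ _
  (fun x a w => tfold (fun u' w' => tfold (fun x' a' =>
     tn (tn (mulR x x') (ev w a' *: a)) w') u') (toT3 t'))); last by linear.
rewrite /tsums3 big_allpairs_dep; apply: eq_bigr => p _.
by rewrite (@tfold_tsums3 _ _ _ _ (fun x' a' w' =>
  tn (tn (mulR p.1.1 x') (ev p.2 a' *: p.1.2)) w')); last by linear.
Qed.

Let dcopT (w w' : D) := toT (dcop Delta w w').

Lemma toT3_bi t t' : toT3 (@bismash_mul A mul Delta phi R mulR act t t') =
  bi_mul d1 (@dslice _ _ Delta phi) dcopT mulR act (toT3 t) (toT3 t').
Proof.
have mRb := bilinear_bil mulR; have ab := bilinear_bil act.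
have nr := mul_nondeg_r HA.
have mul_tril := bi_mulr_tril mb nr d1_bil d2_bil ev_bil ev0 dslice_d2 dcopP mRb ab.
have pure_tril := bi_pure_tril mb nr d1_bil d2_bil ev_bil ev0 dslice_d2 dcopP mRb ab.
rewrite toT3_of /bi_mul (tfold_tsums3 _ (mul_tril _)).
rewrite /tsums3 big_flatten big_allpairs_dep; apply: eq_bigr => p _.
rewrite /bi_mulr (tfold_tsums3 _ (pure_tril _ _ _)); apply: eq_bigr => q _.
rewrite /bismash_pure big_allpairs_dep /bi_pure tfold_tsums; last first.
  by have := bi_pure_bil mb nr d1_bil d2_bil ev_bil dslice_d2 mRb ab p.1.1 p.1.2 q.1.1 q.1.2.
apply: eq_bigr => k _; rewrite tfold_tsums //.
by have := bi_pure_bil1 mRb ab p.1.1 k.2 q.1.1.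
Qed.

Lemma bismash_diamond_iso :
  exists F : tensor3 R A D -> tensor3 R A D,
    alg_iso (@bismash_mul A mul Delta phi R mulR act) (@diamond_mul A mul phi R mulR) F.
Proof.
have mRb := bilinear_bil mulR; have ab := bilinear_bil act.
have [p0 p0_neq0] : exists p0 : A, p0 != 0.
  have [p phip] := phi_nonzero HA; exists p; apply: contraNneq phip => ->.
  by rewrite linear0.
have [T1_inj T1_surj] := d1_bij; have [T3_inj T3_surj] := d3_bij.
have [mA [nl nr]] := (mul_assoc HA, (mul_nondeg_l HA, mul_nondeg_r HA)).
have [eps [eps_lin eps1 eps2]] := counit_exists mb d1_bil d2_bil d12 coassoc12 T1_inj T1_surj
  d2_surj p0_neq0.
have [sigma [sigma_lin sigma_surj sigmaM sigma3]] := antipode_exists mb mA nl nr d1_bil d2_bil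
  d3_bil d12 d32 d1M T1_surj d2_surj T3_inj T3_surj eps_lin eps1 eps2 p0_neq0.
have eps_d4 := eps4 mb mA nl d14 eps_lin eps1.
have [F [F_lin [G FK GK] FM]] := bismash_iso mb mA nl nr d1_bil d2_bil d3_bil d4_bil
  d12 d32 d14 d34 d1M coassoc12 T3_surj eps_d4 sigma_lin sigma3 sigmaM phi_lin phi_inv sigma_surj
  ev_bil ev0 ev_hat hat_surj dslice_d2 dcopP mRb ab (mulR_assoc HR)
  (mulR_nondeg_l HR) (act_mul HR) (act_unital HR) act_d1.
pose of3 (z : ten (ten R A) D) : tensor3 R A D := proj1_sig (cid (toT3_surj z)).
have of3K z : toT3 (of3 z) = z := proj2_sig (cid (toT3_surj z)).
exists (fun t => of3 (F (toT3 t))); split=> [k t t'||t t'].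
- by apply: toT3_inj; rewrite !toT3_add !toT3_scale !of3K F_lin.
- by exists (fun t => of3 (G (toT3 t))) => t; apply: toT3_inj; rewrite !of3K ?FK ?GK.
- by apply: toT3_inj; rewrite of3K toT3_bi FM toT3_dia !of3K.
Qed.

End Quantum.

Theorem theorem7p6
    (A : lmodType CC) (mul : {bilinear A -> A -> A})
    (Delta : A -> multiplier (tmul mul)) (phi : {scalar A})
    (HA : is_AQG Delta phi)
    (R : lmodType CC) (mulR : {bilinear R -> R -> R})
    (act : {bilinear A -> R -> R})
    (HR : is_module_algebra Delta mulR act) :
  exists F : tensor3 R A (dualA mul phi) -> tensor3 R A (dualA mul phi),
    alg_iso (@bismash_mul A mul Delta phi R mulR act)
            (@diamond_mul A mul phi R mulR) F.
Proof. exact (bismash_diamond_iso HA HR). Qed.
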